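(* Let $\mathbf{k}$ be any field and let $Q_2=\operatorname{Spec}(\mathbf{k}[x,y,z]/(xy-z(z+1)))\subset \mathbb{A}^3_{\mathbf{k}}$. There is an infinite set of closed curves $C_i\subset Q_2$, $i\in I$, such that: the $C_i$ are pairwise non-equivalent up to automorphism of $Q_2$ (i.e. for $i\neq j$ there is no $\varphi\in\operatorname{Aut}(Q_2)$ with $\varphi(C_i)=C_j$); each $C_i$ is isomorphic to $\mathbb{A}^1_{\mathbf{k}}$; and for each $i\in I$ the identity is the only automorphism of $C_i$ that extends to an automorphism of $Q_2$. Moreover, if $\mathbf{k}$ is uncountable, then one can choose $I$ to be uncountable.
   Context: Varieties, morphisms and automorphisms are over $\mathbf{k}$; $\operatorname{Aut}(Y)$ is the group of automorphisms of the $\mathbf{k}$-variety $Y$. An automorphism $\beta$ of a closed subvariety $C\subset Y$ extends to $Y$ if there is $\alpha\in\operatorname{Aut}(Y)$ with $\alpha(C)=C$ and $\alpha|_C=\beta$. *)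

(* Defs.v *)
From HB Require Import structures.
From mathcomp Require Import all_boot all_algebra ring_quotient.
From mathcomp Require Import boolp classical_sets functions cardinality.
From mathcomp Require Import mpoly.

Set Implicit Arguments.
Unset Strict Implicit.
Unset Printing Implicit Defensive.

Import GRing.Theory.
Local Open Scope ring_scope.
Local Open Scope quotient_scope.

(* Affine k-varieties are given by their coordinate rings, i.e. commutative
   k-algebras; morphisms X -> Y are k-algebra morphisms k[Y] -> k[X] (pullback
   of functions).  A closed irreducible subvariety is a prime ideal P of k[X],
   with coordinate ring k[X]/P. *)

(* ring_quotient only provides the ring structure of k[X]/J. *)
Section QuotientAlgebra.
Variables (k : fieldType) (A : comAlgType k) (J : idealr A).
Local Notation Q := {ideal_quot J}.

Definition quot_scale (a : k) (x : Q) : Q := \pi_Q (a *: repr x).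

Lemma quot_scaleE a (u : A) : quot_scale a (\pi_Q u) = \pi_Q (a *: u).
Proof.
apply/eqP; rewrite /quot_scale -Quotient.idealrBE -scalerBr -mulr_algl.
by apply: idealMr; rewrite Quotient.idealrBE reprK.
Qed.

Fact quot_scaleA a b x : quot_scale a (quot_scale b x) = quot_scale (a * b) x.
Proof. by rewrite -[x]reprK (quot_scaleE b) !quot_scaleE scalerA. Qed.

Fact quot_scale1 : left_id 1 quot_scale.
Proof. by move=> x; rewrite -[x]reprK quot_scaleE scale1r. Qed.

Fact quot_scaleDr : right_distributive quot_scale +%R.
Proof.
by move=> a x y; rewrite -[x]reprK -[y]reprK -rmorphD !quot_scaleE scalerDr rmorphD.
Qed.

Fact quot_scaleDl x : {morph quot_scale^~ x : a b / a + b}.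
Proof. by move=> a b; rewrite -[x]reprK !quot_scaleE scalerDl rmorphD. Qed.

HB.instance Definition _ := GRing.Zmodule_isLmodule.Build k Q
  quot_scaleA quot_scale1 quot_scaleDr quot_scaleDl.

Fact quot_scaleAl (a : k) (x y : Q) : a *: (x * y) = a *: x * y.
Proof.
rewrite -[x]reprK -[y]reprK -rmorphM.
by rewrite /GRing.scale /= !quot_scaleE -rmorphM scalerAl.
Qed.

HB.instance Definition _ := GRing.Lmodule_isLalgebra.Build k Q quot_scaleAl.

Fact quot_scaleAr (a : k) (x y : Q) : a *: (x * y) = x * (a *: y).
Proof. by rewrite mulrC quot_scaleAl mulrC. Qed.

HB.instance Definition _ := GRing.Lalgebra_isAlgebra.Build k Q quot_scaleAr.

End QuotientAlgebra.

Section AffineVarieties.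
Variable k : fieldType.
Implicit Types A B : comAlgType k.

Definition alg_iso A B := exists f : {lrmorphism A -> B}, bijective f.

(* Strictly increasing chain of n+1 primes, i.e. of length n. *)
Definition prime_chain A (n : nat) :=
  exists p : 'I_n.+1 -> prime_idealr A, forall i j : 'I_n.+1, (i < j)%N ->
    {subset p i <= p j} /\ ~ {subset p j <= p i}.

Definition krull_dim_eq A (n : nat) :=
  forall m : nat, prime_chain A m <-> (m <= n)%N.

Definition closed_curve A (P : prime_idealr A) :=
  krull_dim_eq {ideal_quot P} 1.

(* [phi] is the pullback f |-> f \o a along an automorphism a of the variety,
   and a(V(P)) = V(Q): f vanishes on a(V(P)) iff its pullback vanishes on V(P). *)
Definition maps_onto A (phi : {lrmorphism A -> A}) (P Q : prime_idealr A) :=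
  forall f : A, (phi f \in P) = (f \in Q).

Definition aut_equiv A (P Q : prime_idealr A) :=
  exists phi : {lrmorphism A -> A}, bijective phi /\ maps_onto phi P Q.

Definition aut_extends A (P : prime_idealr A)
    (beta : {lrmorphism {ideal_quot P} -> {ideal_quot P}}) :=
  exists alpha : {lrmorphism A -> A},
    [/\ bijective alpha, maps_onto alpha P P &
        forall f : A, beta (\pi_{ideal_quot P} f) = \pi_{ideal_quot P} (alpha f)].

End AffineVarieties.

Section Q2.
Variable k : fieldType.

Definition Q2_eq : {mpoly k[3]} :=
  let x := 'X_(inord 0) in let y := 'X_(inord 1) in let z := 'X_(inord 2) in
  x * y - z * (z + 1).

Definition Q2_ideal : {mpoly k[3]} -> bool :=
  fun f => `[< exists q : {mpoly k[3]}, f = q * Q2_eq >].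

Fact Q2_idealr_closed : idealr_closed Q2_ideal.
Proof.
split.
- by apply/asboolP; exists 0; rewrite mul0r.
- apply/asboolP => -[q] /(congr1 (mmap idfun (fun _ => 0))).
  rewrite rmorph1 rmorphM /Q2_eq rmorphB !rmorphM /= !mmapX !mmap1U.
  by rewrite !mul0r subr0 mulr0 => /eqP; rewrite oner_eq0.
- move=> a u v /asboolP[q ->] /asboolP[r ->]; apply/asboolP.
  by exists (a * q + r); rewrite mulrDl mulrA.
Qed.

HB.instance Definition _ := isIdealr.Build {mpoly k[3]} Q2_ideal Q2_idealr_closed.

(* Coordinate ring k[x,y,z]/(xy - z(z+1)) of Q_2. *)
Definition Q2 : comAlgType k := {ideal_quot (Q2_ideal : idealr {mpoly k[3]})}.

Definition rigid_line_family (I : Type) (C : I -> prime_idealr Q2) : Prop :=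
  [/\ forall i, closed_curve (C i),
      forall i j, i <> j -> ~ aut_equiv (C i) (C j),
      forall i, alg_iso {ideal_quot (C i)} {poly k} &
      forall i (beta : {lrmorphism {ideal_quot (C i)} -> {ideal_quot (C i)}}),
        bijective beta -> (aut_extends beta <-> beta =1 id)].

End Q2.

(* Main.v *)
Require Import Defs.
From HB Require Import structures.
From mathcomp Require Import all_boot all_order all_algebra ring_quotient ring zify.
From mathcomp Require Import boolp classical_sets functions cardinality.
From mathcomp Require Import mpoly.

(* The curves are [t |-> (f(t), t(1 + t f(t)), t f(t))] with [f = t^a + t^(a-2) + t^(a-3) + s t].
   Give [x], [z], [y] the weights [a], [a + 1], [a + 2]. For an automorphism [phi], the leading form
   of [X = phi(x)] in the graded ring [k[x,y,z]/(xy - z^2)] is invariant under a nontrivial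
   homogeneous degeneration of the additive group action fixing [X]. If it vanished at the leading
   coefficients [(1,1,1)] of the curve, a nonconstant orbit [x = e r^2, y = e s^2, z = e r s] would
   satisfy [e r^(a+2) - s^a = const] with [r, s] coprime, which Mason-Stothers forbids as soon as
   [a] and [a + 2] are nonzero in [k]. Hence the degree of [X] along the curve is its weight. So if
   [phi] carries the curve of [f] to the one of [g] and [deg g <= deg f], then [X = c0 + c1 x], that is
   [g(mu t + nu) = c0 + c1 f(t)], and comparing coefficients gives [f = g], [mu = 1] and [nu = 0]. *)

Set Implicit Arguments.
Unset Strict Implicit.
Unset Printing Implicit Defensive.

Import Order.TTheory GRing.Theory Num.Theory.
Local Open Scope ring_scope.
Local Open Scope quotient_scope.

(** * The coordinate ring of [Q2]: induction and evaluation *)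

Section CoordinateRing.
Variable k : fieldType.

Definition Q2_coord (i : nat) : Q2 k := \pi_(Q2 k) 'X_(inord i).
Local Notation qx := (Q2_coord 0).
Local Notation qy := (Q2_coord 1).
Local Notation qz := (Q2_coord 2).

Lemma Q2_coordE : qx * qy = qz * (qz + 1).
Proof.
rewrite /Q2_coord -(rmorph1 (\pi_(Q2 k))) -rmorphD -!rmorphM.
apply/eqP; rewrite -Quotient.idealrBE; apply/asboolP; exists 1; rewrite mul1r.
by [].
Qed.

Lemma Q2_ind (P : Q2 k -> Prop) :
  P 1 ->
  (forall (c : k) f g, P f -> P g -> P (c *: f + g)) ->
  (forall f, P f -> [/\ P (f * qx), P (f * qy) & P (f * qz)]) ->
  forall f, P f.
Proof.
move=> P1 PD PM f; rewrite -[f]reprK.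
have P0 : P 0 by rewrite -(addNr 1) -scaleN1r; apply: PD.
have PZ i g n : (i < 3)%N -> P g -> P (g * Q2_coord i ^+ n).
  move=> i3 Pg; elim: n => [|n]; first by rewrite mulr1.
  rewrite exprSr mulrA => /PM[].
  by case: i i3 => [|[|[|i]]].
elim/mpolyind: (repr f) => [|c m p _ _ Pp]; first by rewrite rmorph0.
rewrite rmorphD -[X in P (X + _)]quot_scaleE; apply: PD Pp.
have -> : \pi_(Q2 k) 'X_[m] = \prod_(i < 3) Q2_coord i ^+ m i.
  rewrite mpolyXE_id rmorph_prod; apply: eq_bigr => i _.
  by rewrite rmorphXn /= /Q2_coord inord_val.
by rewrite !big_ord_recr big_ord0 /=; do 3![apply: (PZ) => //].
Qed.

Lemma Q2_coord_morph (R : nzRingType) (f : {rmorphism Q2 k -> R}) :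
  f qx * f qy = f qz * (f qz + 1).
Proof. by rewrite -(rmorphM f) Q2_coordE rmorphM rmorphD rmorph1. Qed.

Section Eval.
Variables (R : comNzRingType) (h : {rmorphism k -> R}) (x y z : R).

(** Semilinear along an arbitrary [h], since the targets are iterated polynomial rings with scalars
    embedded as constants. The relation is an argument so that the ring morphism structure can be
    attached to the function itself. *)
Definition Q2_eval of x * y = z * (z + 1) := fun f : Q2 k =>
  mmap h (fun i : 'I_3 => [:: x; y; z]`_i) (repr f).

Hypothesis xyz : x * y = z * (z + 1).

Lemma Q2_eval_pi p : Q2_eval xyz (\pi_(Q2 k) p) = mmap h (fun i : 'I_3 => [:: x; y; z]`_i) p.
Proof.
apply/eqP; rewrite -subr_eq0 -rmorphB /=.
have /asboolP[q ->] : repr (\pi_(Q2 k) p) - p \in Q2_ideal (k := k).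
  by rewrite Quotient.idealrBE reprK.
rewrite rmorphM /= /Q2_eq rmorphB !rmorphM rmorphD rmorph1 /= !mmapX !mmap1U.
by rewrite !inordK //= xyz subrr mulr0.
Qed.

Fact Q2_eval_zmod : zmod_morphism (Q2_eval xyz).
Proof.
move=> f g; rewrite -[f]reprK -[g]reprK -rmorphB !Q2_eval_pi; exact: rmorphB.
Qed.
Fact Q2_eval_monoid : monoid_morphism (Q2_eval xyz).
Proof.
split=> [|f g]; first by rewrite -(rmorph1 (\pi_(Q2 k))) Q2_eval_pi; exact: rmorph1.
rewrite -[f]reprK -[g]reprK -rmorphM !Q2_eval_pi; exact: rmorphM.
Qed.
HB.instance Definition _ := GRing.isZmodMorphism.Build (Q2 k) R (Q2_eval xyz) Q2_eval_zmod.
HB.instance Definition _ := GRing.isMonoidMorphism.Build (Q2 k) R (Q2_eval xyz) Q2_eval_monoid.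

Lemma Q2_eval_scale c f : Q2_eval xyz (c *: f) = h c * Q2_eval xyz f.
Proof.
rewrite -[f]reprK; have -> : c *: \pi_(Q2 k) (repr f) = \pi_(Q2 k) (c *: repr f) by exact: quot_scaleE.
by rewrite !Q2_eval_pi mmapZ.
Qed.

Lemma Q2_eval_x : Q2_eval xyz qx = x.
Proof. by rewrite Q2_eval_pi mmapX mmap1U inordK. Qed.
Lemma Q2_eval_y : Q2_eval xyz qy = y.
Proof. by rewrite Q2_eval_pi mmapX mmap1U inordK. Qed.
Lemma Q2_eval_z : Q2_eval xyz qz = z.
Proof. by rewrite Q2_eval_pi mmapX mmap1U inordK. Qed.
End Eval.
End CoordinateRing.

(* In terms of [u = x] and [v = z / x], this is [u ^ n * v ^ l] up to terms of smaller degree in [u]. *)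
Definition monom (R : comNzRingType) (x y z : R) (n l : nat) :=
  x ^+ (n - uphalf l) * y ^+ l./2 * z ^+ odd l.

(** * Weights and normal forms *)

Section NormalForm.
Variable k : fieldType.
Local Notation qx := (Q2_coord k 0).
Local Notation qy := (Q2_coord k 1).
Local Notation qz := (Q2_coord k 2).
Local Notation qmon := (monom qx qy qz).
Variable a : nat.

(** [qmon n l] with [l <= n.*2] runs over the monomials [x^i y^j z^e] with [e <= 1]: here
    [n = i + j + e] and [l = 2j + e], so [a * n + l] is the weight. *)
Inductive weight_lt (D : nat) : Q2 k -> Prop :=
| weight_lt0 : weight_lt D 0
| weight_ltD c n l f : (l <= n.*2)%N -> (a * n + l < D)%N ->
    weight_lt D f -> weight_lt D (c *: qmon n l + f).

Lemma weight_lt_add D f g : weight_lt D f -> weight_lt D g -> weight_lt D (f + g).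
Proof.
elim=> [|c n l {}f ln D' _ IH] Hg; first by rewrite add0r.
by rewrite -addrA; apply: weight_ltD => //; apply: IH.
Qed.

Lemma weight_lt_scale D c f : weight_lt D f -> weight_lt D (c *: f).
Proof.
elim=> [|d n l {}f ln D' _ IH]; first by rewrite scaler0; constructor.
by rewrite scalerDr scalerA; constructor.
Qed.

Lemma weight_lt_mon D n l : (l <= n.*2)%N -> (a * n + l < D)%N -> weight_lt D (qmon n l).
Proof.
by move=> ln lD; rewrite -[qmon n l]scale1r -[_ *: _]addr0; do !constructor.
Qed.

Lemma weight_lt_leq D E f : (D <= E)%N -> weight_lt D f -> weight_lt E f.
Proof.
move=> DE; elim=> [|d n l {}f ln D' _ IH]; first by constructor.
by constructor => //; apply: leq_trans DE.
Qed.

(** Only the product with [qz] for odd [l] needs the equation of the surface: [z^2 = x y - z] splits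
    off a term of smaller weight. *)
Lemma qmon_mul n l : (l <= n.*2)%N ->
  [/\ qmon n l * qx = qmon n.+1 l, qmon n l * qy = qmon n.+1 l.+2 &
      qmon n l * qz = qmon n.+1 l.+1 - (odd l)%:R * qmon n l].
Proof.
move=> ln; rewrite /monom /=.
have lh : (uphalf l <= n)%N by rewrite -(doubleK n) uphalf_half; lia.
split.
- by rewrite subSn // exprS; ring.
- by rewrite negbK subSS exprS; ring.
case ol: (odd l) => /=; last first.
  rewrite uphalf_half ol add0n expr0 expr1 subSS; ring.
move: lh; rewrite uphalf_half ol add1n => lh.
rewrite subSS -[(n - l./2)%N](subnSK lh) !exprS.
have -> : forall u v : Q2 k, (qx * u) * (qy * v) * qz ^+ false = u * v * (qx * qy).
  by move=> u v; rewrite expr0; ring.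
rewrite Q2_coordE; ring.
Qed.

Lemma weight_lt_ex f : exists D, weight_lt D f.
Proof.
elim/Q2_ind: f => [|c f g [D Df] [E Eg]|f [D Df]].
- exists 1%N; have -> : 1 = qmon 0 0 by rewrite /monom !expr0 !mulr1.
  by apply: weight_lt_mon; rewrite ?muln0.
- exists (maxn D E); apply: weight_lt_add.
    by apply: weight_lt_scale; apply: weight_lt_leq Df; apply: leq_maxl.
  by apply: weight_lt_leq Eg; apply: leq_maxr.
suff H i : (i < 3)%N -> weight_lt (D + a + 3) (f * Q2_coord k i).
  by split; exists (D + a + 3)%N; apply: H.
move=> i3; elim: Df => [|c n l {}f ln lD _ IH]; first by rewrite mul0r; constructor.
have [mx my mz] := qmon_mul ln.
rewrite mulrDl -scalerAl; apply: weight_lt_add (IH); apply: weight_lt_scale.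
case: i i3 {IH} => [|[|[|//]]] _.
- by rewrite mx; apply: weight_lt_mon; lia.
- by rewrite my; apply: weight_lt_mon; lia.
rewrite mz mulr_natl -scaler_nat -scaleNr; apply: weight_lt_add; last apply: weight_lt_scale.
  by apply: weight_lt_mon; lia.
by apply: weight_lt_mon; lia.
Qed.

(** The bounds say that [l = D - a n] satisfies [0 <= l <= 2n]. In weight [D] the index [n]
    determines the monomial, so a homogeneous element is encoded by a univariate [q], and [q.[1]] is
    its value at [(1,1,1)]. *)
Definition admissible D (q : {poly k}) :=
  forall n, q`_n != 0 -> (a * n <= D <= a.+2 * n)%N.

Definition leading_part D (q : {poly k}) : Q2 k :=
  \sum_(n < size q) q`_n *: qmon n (D - a * n).

Lemma leading_partD D : {morph leading_part D : p q / p + q}.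
Proof.
move=> p q; have E (r : {poly k}) : (size r <= maxn (size p) (size q))%N ->
    leading_part D r = \sum_(n < maxn (size p) (size q)) r`_n *: qmon n (D - a * n).
  move=> sr; rewrite /leading_part (big_ord_widen _ (fun n => r`_n *: qmon n (D - a * n)) sr) big_mkcond.
  by apply: eq_bigr => i _; case: ltnP => // ri; rewrite nth_default // scale0r.
rewrite !E ?leq_maxl ?leq_maxr ?size_polyD // -big_split.
by apply: eq_bigr => i _; rewrite coefD scalerDl.
Qed.

Lemma weight_ltS D f : weight_lt D.+1 f ->
  exists q, admissible D q /\ weight_lt D (f - leading_part D q).
Proof.
elim=> [|c n l {}f ln lD _ [q [adq Fq]]].
  exists 0; split=> [n|]; first by rewrite coef0 eqxx.
  by rewrite /leading_part size_poly0 big_ord0 subr0; constructor.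
have [lD'|lD'] := ltnP (a * n + l) D.
  by exists q; split => //; rewrite -addrA; constructor.
have nD : (a * n <= D)%N by lia.
have {lD lD'} lE : l = (D - a * n)%N by lia.
exists (c *: 'X^n + q); split.
  move=> m; rewrite coefD coefZ coefXn; have [->|nm] := eqVneq m n; last first.
    by rewrite mulr0 add0r; apply: adq.
  by move=> _; lia.
rewrite leading_partD opprD addrACA [X in X + _](_ : _ = 0) ?add0r //.
apply/eqP; rewrite subr_eq0; apply/eqP.
rewrite /leading_part lE; have [->|c0] := eqVneq c 0.
  by rewrite !scale0r size_poly0 big_ord0.
rewrite size_scale // size_polyXn big_ord_recr /= big1 ?add0r => [|i _].
  by rewrite coefZ coefXn eqxx mulr1.
by rewrite coefZ coefXn (ltn_eqF (ltn_ord i)) mulr0 scale0r.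
Qed.

(** Descent on the weight bound: an empty top layer lowers [D], and only [0] has weight below
    [0]. *)
Lemma leading_part_ex f : f != 0 ->
  exists D q, [/\ q != 0, admissible D q & weight_lt D (f - leading_part D q)].
Proof.
move=> f0; have [D] := weight_lt_ex f; elim: D => [|D IH] fD.
  have : forall E g, weight_lt E g -> E = 0%N -> g = 0.
    by move=> E g; elim=> // c n l h _ lE _ _ E0; rewrite E0 in lE.
  by move=> /(_ _ _ fD erefl) f00; rewrite f00 eqxx in f0.
have [q [adq fq]] := weight_ltS fD; have [q0|q0] := eqVneq q 0.
  by apply: IH; rewrite q0 /leading_part size_poly0 big_ord0 subr0 in fq.
by exists D, q.
Qed.

End NormalForm.

Lemma monom_diag (R : comNzRingType) (g : R) n l : (l <= n.*2)%N -> monom g g g n l = g ^+ n.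
Proof.
move=> ln; rewrite /monom -!exprD uphalf_half; congr (_ ^+ _).
by have := odd_double_half l; lia.
Qed.

(** * Leading symbols along a ring morphism *)

Section SymbolCalculus.
Variables (k : fieldType) (S U : comNzRingType).
Variables (hS : {rmorphism k -> S}) (hU : {rmorphism k -> U}).

(* [sym D f u]: [f] has degree at most [D] and [u] is its component of degree [D]. *)
Record is_symbol (sym : nat -> S -> U -> Prop) : Prop := IsSymbol {
  symC : forall c, sym 0 (hS c) (hU c);
  symD : forall D f g u v, sym D f u -> sym D g v -> sym D (f + g) (u + v);
  symM : forall D E f g u v, sym D f u -> sym E g v -> sym (D + E)%N (f * g) (u * v);
  symW : forall D E f u, sym D f u -> (D < E)%N -> sym E f 0 }.

Variables (sym : nat -> S -> U -> Prop) (symP : is_symbol sym).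

Lemma sym0 D : sym D 0 0.
Proof.
have S0 : sym 0 0 0 by have := symC symP 0; rewrite !rmorph0.
by case: D => // D; apply: symW S0 _.
Qed.

Lemma symX D f u n : sym D f u -> sym (D * n)%N (f ^+ n) (u ^+ n).
Proof.
move=> Dfu; elim: n => [|n IH]; first by have := symC symP 1; rewrite !rmorph1 muln0.
by rewrite !exprS mulnS; apply: (symM symP).
Qed.

Variable (a : nat) (Phi : {rmorphism Q2 k -> S}).
Hypothesis Phi_scale : forall c f, Phi (c *: f) = hS c * Phi f.
Variables (xh yh zh : U).
Local Notation qx := (Q2_coord k 0).
Local Notation qy := (Q2_coord k 1).
Local Notation qz := (Q2_coord k 2).
Hypothesis symx : sym a (Phi qx) xh.
Hypothesis symy : sym a.+2 (Phi qy) yh.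
Hypothesis symz : sym a.+1 (Phi qz) zh.

Lemma sym_monom n l : (l <= n.*2)%N ->
  sym (a * n + l)%N (Phi (monom qx qy qz n l)) (monom xh yh zh n l).
Proof.
move=> ln; rewrite /monom !rmorphM !rmorphXn /=.
have -> : (a * n + l = a * (n - uphalf l) + a.+2 * l./2 + a.+1 * odd l)%N.
  have := odd_double_half l; rewrite uphalf_half.
  have [m ->] : exists m, (n = m + (odd l + l./2))%N.
    by exists (n - (odd l + l./2))%N; have := odd_double_half l; lia.
  by rewrite addnK; lia.
by do 2?apply: (symM symP); apply: symX.
Qed.

Lemma sym_scale D c f u : sym D f u -> sym D (hS c * f) (hU c * u).
Proof. by move=> Dfu; rewrite -[D]add0n; apply: (symM symP) => //; apply: symC. Qed.

Lemma sym_weight_lt D f : weight_lt a D f -> sym D (Phi f) 0.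
Proof.
elim=> [|c n l {}f ln lD _ IH]; first by rewrite rmorph0; apply: sym0.
rewrite rmorphD Phi_scale -[0]add0r; apply: (symD symP) => //.
by apply: (symW symP) lD; apply: sym_scale; apply: sym_monom.
Qed.

(** All monomials of weight below [D] have symbol [0] in degree [D], so only the leading part
    contributes, with the coordinates replaced by their symbols. The resulting component may itself
    vanish. *)
Lemma sym_leading D q f : admissible a D q -> weight_lt a D (f - leading_part a D q) ->
  sym D (Phi f) (\sum_(n < size q) hU q`_n * monom xh yh zh n (D - a * n)).
Proof.
move=> adq /sym_weight_lt fq; rewrite -[f](subrK (leading_part a D q)) rmorphD -[X in sym _ _ X]add0r.
apply: (symD symP) fq _; rewrite /leading_part rmorph_sum /=.
apply: (big_ind2 (sym D)) => [||n _]; first exact: sym0.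
  by move=> *; apply: (symD symP).
rewrite Phi_scale; have [->|qn] := eqVneq q`_n 0; first by rewrite !rmorph0 !mul0r; apply: sym0.
have /andP[lD Du] := adq _ qn; apply: sym_scale.
by rewrite -[X in sym X](subnKC lD); apply: sym_monom; lia.
Qed.

End SymbolCalculus.

(** * Lines in the surface and degrees along them *)

Section TopCoefficient.
Variables (k : fieldType) (R : comNzRingType) (h : {rmorphism k -> R}).

Definition has_top D (f : {poly R}) (u : R) := (size f <= D.+1)%N /\ f`_D = u.

Lemma has_top_symbol : is_symbol (polyC \o h) h has_top.
Proof.
split=> [c|D f g u v [sf fu] [sg gv]|D E f g u v [sf fu] [sg gv]|D E f u [sf fu] DE].
- by split; rewrite ?size_polyC_leq1 ?coefC.
- by split; [apply: leq_trans (size_polyD _ _) _; rewrite geq_max sf | rewrite coefD fu gv].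
- split; first by apply: leq_trans (size_polyMleq _ _) _; lia.
  rewrite coefM (bigD1 (inord D)) //= inordK ?ltnS ?leq_addr //.
  rewrite addKn fu gv big1 ?addr0 // => i iD.
  have {}iD : nat_of_ord i != D.
    by apply: contraNneq iD => iD; apply/eqP/val_inj; rewrite /= inordK // ltnS leq_addr.
  have [lt|le] := ltnP i D.
    by rewrite [g`_ _]nth_default ?mulr0 // (leq_trans sg) // ltn_subRL ltn_add2r.
  by rewrite nth_default ?mul0r // (leq_trans sf) // ltn_neqAle eq_sym iD.
split; first by apply: leq_trans sf _; apply: ltnW.
by rewrite nth_default //; apply: leq_trans sf _.
Qed.

Fact line_eq (f : {poly R}) : f * ('X * (1 + 'X * f)) = 'X * f * ('X * f + 1).
Proof. by ring. Qed.

Definition line (f : {poly R}) : Q2 k -> {poly R} := Q2_eval (polyC \o h) (line_eq f).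

HB.instance Definition _ f := GRing.RMorphism.on (line f).

Lemma line_scale f c q : line f (c *: q) = (h c)%:P * line f q.
Proof. exact: Q2_eval_scale. Qed.

Lemma line_x f : line f (Q2_coord k 0) = f. Proof. exact: Q2_eval_x. Qed.
Lemma line_y f : line f (Q2_coord k 1) = 'X * (1 + 'X * f). Proof. exact: Q2_eval_y. Qed.
Lemma line_z f : line f (Q2_coord k 2) = 'X * f. Proof. exact: Q2_eval_z. Qed.

Section Top.
Variables (a : nat) (f : {poly R}) (g : R).
Hypothesis (fg : has_top a f g).

Let topX : has_top 1 'X 1. Proof. by split; rewrite ?size_polyX ?coefX. Qed.

Lemma line_top_x : has_top a (line f (Q2_coord k 0)) g.
Proof. by rewrite line_x. Qed.

Lemma line_top_z : has_top a.+1 (line f (Q2_coord k 2)) g.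
Proof.
by rewrite line_z -[g]mul1r; apply: (symM has_top_symbol topX).
Qed.

Lemma line_top_y : has_top a.+2 (line f (Q2_coord k 1)) g.
Proof.
rewrite line_y -(line_z f) -[g]mul1r; apply: (symM (E := a.+1) has_top_symbol topX).
rewrite -[g]add0r; apply: (symD has_top_symbol); last exact: line_top_z.
have := symC has_top_symbol 1; rewrite !rmorph1 => t1.
exact: (symW has_top_symbol) t1 _.
Qed.

(** The coordinates of the line have the same leading coefficient [g], so [monom_diag] applies. This
    is used with [g = 1] on the curves, and with [g] a variable, where the coefficient is [q]
    itself. *)
Lemma line_top D q F : admissible a D q -> weight_lt a D (F - leading_part a D q) ->
  has_top D (line f F) (map_poly h q).[g].
Proof.
move=> adq /(sym_leading has_top_symbol (line_scale f) line_top_x line_top_y line_top_z adq).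
rewrite (@horner_coef_wide _ (size q)) ?size_poly //; congr (has_top _ _ _).
apply: eq_bigr => n _; rewrite coef_map_id0 ?rmorph0 //.
have [->|/adq/andP[lD Du]] := eqVneq q`_n 0; first by rewrite !rmorph0 !mul0r.
by rewrite monom_diag //; lia.
Qed.

End Top.
End TopCoefficient.

(** * A Mason-Stothers argument, and polynomial curves on the cone [x y = z^2] *)

Lemma deriv0_comp_Xp (F : fieldType) (p : nat) (r : {poly F}) :
  p \in [pchar F] -> r^`() = 0 -> exists r1, r = r1 \Po 'X^p.
Proof.
move=> pF r'0; have p0 : (0 < p)%N by rewrite prime_gt0 // (pcharf_prime pF).
exists (\poly_(i < size r) r`_(i * p)); apply/polyP => i.
rewrite coef_comp_poly_Xn // coef_poly; case: ifP => pi; last first.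
  case: i pi => [|i] pi; first by rewrite dvdn0 in pi.
  have /eqP : r^`()`_i = 0 by rewrite r'0 coef0.
  by rewrite coef_deriv -mulr_natr mulf_eq0 -(dvdn_pcharf pF) pi orbF => /eqP.
rewrite divnK //; case: ltnP => // ri; rewrite nth_default //.
by apply: leq_trans ri (leq_div _ _).
Qed.

Lemma deriv0_pchar (F : fieldType) (r : {poly F}) :
  (1 < size r)%N -> r^`() = 0 -> exists p, p \in [pchar F].
Proof.
move=> r1 r'0; have : r^`()`_(size r).-2 = 0 by rewrite r'0 coef0.
rewrite coef_deriv prednK; last by lia.
move/eqP; rewrite -mulr_natr mulf_eq0 -/(lead_coef r) lead_coef_eq0 -size_poly_eq0.
case/orP => [/eqP r0|]; first by rewrite r0 in r1.
by case/natf0_pchar => [|p]; [lia | exists p].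
Qed.

Lemma coprimep_comp_inv (F : fieldType) (p q h : {poly F}) : (1 < size h)%N ->
  coprimep (p \Po h) (q \Po h) -> coprimep p q.
Proof.
move=> h1 /coprimepP cop; apply/coprimepP => d dp dq.
have := cop _ (dvdp_comp_poly h dp) (dvdp_comp_poly h dq).
rewrite -!size_poly_eq1 => /eqP sd.
have : d != 0 by apply: contraTneq isT => d0; rewrite d0 comp_poly0 size_poly0 in sd.
rewrite -size_poly_gt0 => d0; have := size_comp_poly d h; rewrite sd.
move/esym/eqP; rewrite muln_eq0.
by case/orP; [case: (size d) d0 => [|[|]] | case: (size h) h1 => [|[|]]].
Qed.

(* Mason-Stothers: differentiation gives [r ^ (a+1) | s'] and [s ^ (a-1) | r'], so both derivatives
   vanish; in characteristic [p], [r] and [s] are then polynomials in [X ^ p] and one descends. *)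
Lemma pow_diff_const (F : fieldType) (a : nat) (c : F) (r s : {poly F}) :
  (1 < a)%N -> a%:R != 0 :> F -> a.+2%:R != 0 :> F -> c != 0 -> coprimep r s ->
  (size (c *: r ^+ a.+2 - s ^+ a)%R <= 1)%N -> (size r <= 1)%N /\ (size s <= 1)%N.
Proof.
move=> a1 a0 a20 c0; move: {2}(size r + size s)%N (leqnn (size r + size s)) => m.
elim: m r s => [|m IH] r s rsm cop sz; first by lia.
have [r0|r0] := eqVneq r 0.
  by move: cop; rewrite r0 coprime0p -size_poly_eq1 size_poly0 => /eqP->.
have [s0|s0] := eqVneq s 0.
  by move: cop; rewrite s0 coprimep0 -size_poly_eq1 size_poly0 => /eqP->.
have dE : (c * a.+2%:R) *: (r^`() * r ^+ a.+1) = a%:R *: (s^`() * s ^+ a.-1).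
  apply/eqP; rewrite -subr_eq0; apply/eqP.
  have := congr1 deriv (size1_polyC sz).
  by rewrite derivC derivB derivZ !deriv_exp -!scaler_nat scalerA.
have ca : c * a.+2%:R != 0 by rewrite mulf_neq0.
have r_s : r ^+ a.+1 %| s^`().
  have : r ^+ a.+1 %| a%:R *: (s^`() * s ^+ a.-1) by rewrite -dE dvdpZr // dvdp_mull.
  by rewrite dvdpZr // Gauss_dvdpl // coprimep_expl // coprimep_expr.
have s_r : s ^+ a.-1 %| r^`().
  have : s ^+ a.-1 %| (c * a.+2%:R) *: (r^`() * r ^+ a.+1) by rewrite dE dvdpZr // dvdp_mull.
  by rewrite dvdpZr // Gauss_dvdpl // coprimep_expl // coprimep_expr // coprimep_sym.
have [r'0|r'0] := eqVneq r^`() 0; last first.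
  have s'0 : s^`() != 0.
    apply: contraNneq r'0 => s'0; move: dE; rewrite s'0 mul0r scaler0 => /eqP.
    by rewrite scaler_eq0 (negbTE ca) mulf_eq0 expf_eq0 (negbTE r0) andbF orbF.
  (* In degrees: [deg r <= (a + 1) deg r <= deg s' < deg s] and
     [deg s <= (a - 1) deg s <= deg r' < deg r], which is absurd. *)
  have := dvdp_leq s'0 r_s; have := dvdp_leq r'0 s_r.
  have := lt_size_deriv r0; have := lt_size_deriv s0.
  have p_r : ((size r).-1 <= (size (r ^+ a.+1)).-1)%N by rewrite size_exp leq_pmulr.
  have p_s : ((size s).-1 <= (size (s ^+ a.-1)).-1)%N.
    by rewrite size_exp leq_pmulr // -ltnS prednK // ltnW.
  rewrite -!size_poly_gt0 in r'0 s'0; move: r'0 s'0 p_r p_s.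
  move: (size r) (size s) (size r^`()) (size s^`()) (size (r ^+ a.+1)) (size (s ^+ a.-1)).
  by lia.
have s'0 : s^`() = 0.
  move: dE; rewrite r'0 mul0r scaler0 => /esym/eqP.
  by rewrite scaler_eq0 (negbTE a0) mulf_eq0 expf_eq0 (negbTE s0) andbF orbF => /eqP.
case: (boolP ((size r <= 1) && (size s <= 1))%N) => [/andP//|].
rewrite negb_and -!ltnNge => nc.
have [p pF] : exists p, p \in [pchar F].
  by case/orP: nc => h; [apply: deriv0_pchar h r'0 | apply: deriv0_pchar h s'0].
have [r1 rE] := deriv0_comp_Xp pF r'0; have [s1 sE] := deriv0_comp_Xp pF s'0.
have p1 : (1 < p)%N by rewrite prime_gt1 // (pcharf_prime pF).
have sXp : size ('X^p : {poly F}) = p.+1 by rewrite size_polyXn.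
have size_comp (u : {poly F}) : (size (u \Po 'X^p)%R).-1 = ((size u).-1 * p)%N.
  by rewrite size_comp_poly sXp.
have cop1 : coprimep r1 s1.
  by apply: (@coprimep_comp_inv _ _ _ 'X^p); rewrite ?sXp -?rE -?sE // ltnS ltnW.
have le1 i j : (i <= 1)%N -> i.-1 = (j.-1 * p)%N -> (j <= 1)%N.
  by case: i => [|[|?]] // _ /esym/eqP; rewrite muln_eq0 (gtn_eqF (ltnW p1)) orbF; case: j => [|[|?]].
have le1' i j : (j <= 1)%N -> i.-1 = (j.-1 * p)%N -> (i <= 1)%N.
  by case: j => [|[|?]] // _; rewrite mul0n; case: i => [|[|?]].
have lt i j : (0 < i)%N -> i.-1 = (j.-1 * p)%N -> (j <= i)%N.
  by case: i => // i _; case: j => // j /= ->; rewrite ltnS leq_pmulr // ltnW.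
have lt1 i j : (1 < i)%N -> i.-1 = (j.-1 * p)%N -> (j < i)%N.
  by case: i => [|[|i]] // _; case: j => [|[|j]] //= ->; rewrite ltnS ltn_Pmulr.
have sz1 : (size (c *: r1 ^+ a.+2 - s1 ^+ a)%R <= 1)%N.
  apply: le1 sz _; rewrite -size_comp; congr (size _).-1.
  by rewrite comp_polyB comp_polyZ !rmorphXn /= -rE -sE.
have [rr ss] := (size_comp r1, size_comp s1); rewrite -rE -sE in rr ss.
rewrite -!size_poly_gt0 in r0 s0.
have [|r1s s1s] := IH r1 s1 _ cop1 sz1; last by split; [apply: le1' rr | apply: le1' ss].
rewrite -ltnS; apply: leq_trans rsm; case/orP: nc => h.
  by rewrite -addSn; apply: leq_add (lt1 _ _ h rr) (lt _ _ s0 ss).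
by rewrite -addnS; apply: leq_add (lt _ _ r0 rr) (lt1 _ _ h ss).
Qed.

(** With [d] the gcd of [x] and [z], and [r], [s] the coprime cofactors, the relation reads
    [r y = d s^2]; hence [r] divides [d], and [e] is the quotient. *)
Lemma mul_eq_sqr_factor (F : fieldType) (x y z : {poly F}) : x != 0 -> x * y = z ^+ 2 ->
  exists e r s, [/\ x = e * r ^+ 2, y = e * s ^+ 2, z = e * r * s & coprimep r s].
Proof.
move=> x0 xyz; pose d := gcdp x z.
have d0 : d != 0 by rewrite gcdp_eq0 negb_and x0.
have [r xE] := dvdpP _ _ (dvdp_gcdl x z); have [s zE] := dvdpP _ _ (dvdp_gcdr x z).
rewrite -/d in xE zE.
have cop : coprimep r s.
  have xz : (x != 0) || (z != 0) by rewrite x0.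
  have := coprimep_div_gcd xz.
  by rewrite -/d {1}xE {1}zE !mulpK.
have ryE : r * y = d * s ^+ 2.
  by apply: (mulfI d0); rewrite mulrA (mulrC d r) -xE xyz zE; ring.
have /dvdpP[e dE] : r %| d.
  have : r %| d * s ^+ 2 by rewrite -ryE dvdp_mulr.
  by rewrite Gauss_dvdpl // coprimep_expr.
have r0 : r != 0 by apply: contraNneq x0 => r0; rewrite xE r0 mul0r.
exists e, r, s; split => //.
- by rewrite xE dE; ring.
- by apply: (mulfI r0); rewrite ryE dE; ring.
by rewrite zE dE; ring.
Qed.

Lemma monom_factor (R : comNzRingType) (e r s : R) n l : (l <= n.*2)%N ->
  monom (e * r ^+ 2) (e * s ^+ 2) (e * r * s) n l = e ^+ n * r ^+ (n.*2 - l) * s ^+ l.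
Proof.
move=> ln; have sqE (u v : R) i : (u * v ^+ 2) ^+ i = u ^+ i * v ^+ (2 * i).
  by rewrite exprMn exprM.
rewrite /monom !sqE -mulrA exprMn uphalf_half mulrA exprMn.
have lE := odd_double_half l.
have [m mE] : exists m, n = (m + (odd l + l./2))%N.
  by exists (n - (odd l + l./2))%N; lia.
have -> : (n - (odd l + l./2) = m)%N by lia.
have -> : (n.*2 - l = 2 * m + odd l)%N by lia.
by rewrite mE -[in s ^+ l]lE -mul2n !exprD; ring.
Qed.

(** * Homogeneous polynomials that are constant along a curve on the cone *)

Section ConstantSymbol.
Variables (k F : fieldType) (h : {rmorphism k -> F}) (a D : nat).
Hypotheses (a1 : (1 < a)%N) (a0 : a%:R != 0 :> k) (a20 : a.+2%:R != 0 :> k).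

(** On [x = e r^2], [y = e s^2], [z = e r s], consecutive terms [T n] have ratio [e r^(a+2) / s^a].
    As [q.[1] = 0], the sum is a multiple of [w = e r^(a+2) - s^a]; it is also a multiple of [e].
    Both divide the constant [c != 0], hence are constant, and [pow_diff_const] applies. *)
Lemma leading_const (x y z : {poly F}) (q : {poly k}) (c : F) :
  x * y = z ^+ 2 -> x != 0 -> (0 < D)%N -> admissible a D q -> c != 0 -> q.[1] = 0 ->
  \sum_(n < size q) (h q`_n)%:P * monom x y z n (D - a * n) = c%:P ->
  [/\ (size x <= 1)%N, (size y <= 1)%N & (size z <= 1)%N].
Proof.
move=> xyz x0 D0 adq c0 q1 sumE.
have [e [r [s [xE yE zE cop]]]] := mul_eq_sqr_factor x0 xyz.
pose T n := e ^+ n * r ^+ (n.*2 - (D - a * n)) * s ^+ (D - a * n).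
have {}sumE : \sum_(n < size q) (h q`_n)%:P * T n = c%:P.
  rewrite -sumE; apply: eq_bigr => n _; have [->|/adq ad] := eqVneq q`_n 0.
    by rewrite rmorph0 !mul0r.
  by rewrite xE yE zE monom_factor //; lia.
have e_c : e %| c%:P.
  rewrite -sumE; apply: (big_ind (fun p => e %| p)) => [||n _]; first exact: dvdp0.
    by move=> *; apply: dvdp_add.
  have [->|/adq ad] := eqVneq q`_n 0; first by rewrite rmorph0 mul0r dvdp0.
  (* [D > 0] excludes [n = 0], so every term contains [e]. *)
  rewrite dvdp_mull // /T -mulrA dvdp_mulr //; case: (nat_of_ord n) ad => [|m _]; first by lia.
  by rewrite exprS dvdp_mulr.
have se : size e = 1%N.
  have := dvdp_leq _ e_c; rewrite polyC_eq0 size_polyC c0 => /(_ isT) e1.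
  by apply/eqP; rewrite eqn_leq e1 size_poly_gt0; apply: contraNneq x0 => e0; rewrite xE e0 mul0r.
have [e0 e0n eE] := size_poly1P _ (introT eqP se).
pose w := e * r ^+ a.+2 - s ^+ a.
have wT m j : (a * (m + j) <= D <= a.+2 * m)%N -> w %| T (m + j)%N - T m.
  move=> mj; pose B := e ^+ m * r ^+ (m.*2 - (D - a * m)) * s ^+ (D - a * (m + j)).
  have -> : T (m + j)%N - T m = ((e * r ^+ a.+2) ^+ j - (s ^+ a) ^+ j) * B.
    rewrite /T /B.
    have -> : ((m + j).*2 - (D - a * (m + j)) = (m.*2 - (D - a * m)) + a.+2 * j)%N by nia.
    have -> : ((D - a * m) = (D - a * (m + j)) + a * j)%N by nia.
    set i1 := (m.*2 - _)%N; set i2 := (D - a * (m + j))%N.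
    rewrite (exprD e) (exprD r i1) (exprD s i2) (exprM r) (exprM s).
    by move: (r ^+ a.+2) (s ^+ a) => u v; rewrite (exprMn j e u); ring.
  by rewrite subrXX -/w -mulrA dvdp_mulr.
have w_c : w %| c%:P.
  have q0 : q != 0.
    apply: contraNneq c0 => q0; move/eqP: sumE.
    by rewrite q0 size_poly0 big_ord0 eq_sym polyC_eq0.
  have sumh : \sum_(n < size q) (h q`_n)%:P = 0 :> {poly F}.
    have sum0 : \sum_(n < size q) q`_n = 0.
      by rewrite -[RHS]q1 horner_coef; apply: eq_bigr => n _; rewrite expr1n mulr1.
    by rewrite -!rmorph_sum /= sum0 !rmorph0.
  pose N := (size q).-1; have adN := adq N _.
  (* The coefficients add up to [q.[1] = 0], so the top term [T N] may be subtracted from each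
     [T n]; by [wT] the differences are multiples of [w]. *)
  have -> : c%:P = \sum_(n < size q) ((h q`_n)%:P * T n - (h q`_n)%:P * T N).
    by rewrite sumrB sumE -mulr_suml sumh mul0r subr0.
  apply: (big_ind (fun p => w %| p)) => [||n _]; first exact: dvdp0.
    by move=> *; apply: dvdp_add.
  have [->|/adq ad] := eqVneq q`_n 0; first by rewrite rmorph0 !mul0r subrr dvdp0.
  rewrite -mulrBr dvdp_mull // -opprB dvdpNr.
  have nN : (n <= N)%N by rewrite -ltnS /N prednK // size_poly_gt0.
  rewrite -(subnKC nN); apply: wT; rewrite subnKC //.
  have := adN; rewrite -/(lead_coef q) lead_coef_eq0 => /(_ q0).
  by move: ad; do 2!case/andP => ? ?; apply/andP.
have sw : (size w <= 1)%N.
  by have := dvdp_leq _ w_c; rewrite polyC_eq0 size_polyC c0 => /(_ isT).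
have := @pow_diff_const F a e0 r s a1; rewrite -!(rmorph_nat h) !fmorph_eq0.
rewrite /w eE mul_polyC in sw.
move=> /(_ a0 a20 e0n cop sw)[sr ss].
have const (u v : {poly F}) : (size u <= 1)%N -> (size v <= 1)%N -> (size (u * v)%R <= 1)%N.
  by move=> su sv; rewrite (size1_polyC su) (size1_polyC sv) -polyCM size_polyC_leq1.
have ec : (size e <= 1)%N by rewrite se.
by rewrite xE yE zE !expr2; split; do !apply: (const).
Qed.
End ConstantSymbol.

(** * Degeneration by a Rees-type substitution *)

Section ReesSymbol.
Variables (k : fieldType) (R : idomainType) (h : {rmorphism k -> R}).
Variables (sigma : nat) (rho : int).
Hypothesis sigma0 : (0 < sigma)%N.

Local Notation Fr := {fraction {poly {poly R}}}.

(* [rees_eval] substitutes [v = s ^ (- sigma)] and [T = t * s ^ rho] in a polynomial in [T] (outer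
   variable) and [v], so that leading terms for the weights [sigma] of [v] and [- rho] of [T] are
   values at [s = 0]; [rho] may be negative. *)
Definition rees_s : Fr := tofrac 'X.
Definition rees_t : Fr := tofrac ('X%:P).
Definition rees_const : {rmorphism R -> Fr} := (@tofrac _) \o (polyC \o polyC).

Definition rees_eval1 : {rmorphism {poly R} -> Fr} :=
  horner_eval (rees_s ^- sigma) \o map_poly rees_const.

Definition rees_eval : {rmorphism {poly {poly R}} -> Fr} :=
  horner_eval (rees_t * rees_s ^ rho) \o map_poly rees_eval1.

Lemma rees_eval_const c : rees_eval c%:P%:P = rees_const c.
Proof.
rewrite -[LHS]/(map_poly rees_eval1 c%:P%:P).[rees_t * rees_s ^ rho] map_polyC hornerC.
by rewrite -[LHS]/(map_poly rees_const c%:P).[rees_s ^- sigma] map_polyC hornerC.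
Qed.

(** The pole of [f] at [s = 0] has order at most [sigma * D], and [u] is the value of
    [s^(sigma D) f] there; the outer variable of [P] is [s], the inner one [t]. *)
Definition has_rees D (f : Fr) (u : {poly R}) :=
  exists P : {poly {poly R}}, f * rees_s ^+ (sigma * D) = tofrac P /\ P`_0 = u.

Lemma has_rees_symbol : is_symbol (rees_const \o h) (polyC \o h) has_rees.
Proof.
split=> [c|D f g u v [P [fP Pu]] [Q [gQ Qv]]|D E f g u v [P [fP Pu]] [Q [gQ Qv]]|D E f u [P [fP Pu]] DE].
- by exists (h c)%:P%:P; rewrite muln0 mulr1 coefC.
- by exists (P + Q); rewrite mulrDl fP gQ rmorphD coefD Pu Qv.
- exists (P * Q); rewrite coef0M Pu Qv tofracM -fP -gQ mulnDr exprD; split=> //; ring.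
exists (P * 'X^(sigma * (E - D))); rewrite coefMXn muln_gt0 sigma0 subn_gt0 DE tofracM -fP.
split=> //; rewrite -{1}(subnKC (ltnW DE)) mulnDr exprD mulrA.
by rewrite tofracXn.
Qed.

Lemma has_rees_uniq D f u v : has_rees D f u -> has_rees D f v -> u = v.
Proof.
by move=> [P [fP <-]] [Q [fQ <-]]; have /eqP := etrans (esym fP) fQ; rewrite tofrac_eq => /eqP->.
Qed.

Lemma has_rees_term D i j c : (sigma%:Z * j%:Z <= sigma%:Z * D%:Z + rho * i%:Z)%R ->
  has_rees D (rees_const c * rees_s ^- sigma ^+ j * (rees_t * rees_s ^ rho) ^+ i)
    (if (sigma%:Z * D%:Z + rho * i%:Z == sigma%:Z * j%:Z)%R then c *: 'X^i else 0).
Proof.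
(* [e] is the exponent of [s] once the term is multiplied by [s^(sigma D)]. It is nonnegative before
   taking the absolute value, by [le], and the term survives at [s = 0] exactly when it is zero. *)
move=> le; pose e := `|(sigma%:Z * D%:Z + rho * i%:Z - sigma%:Z * j%:Z)%R|%N.
exists ((c *: 'X^i)%:P * 'X^e); split; last first.
  rewrite coefMXn sub0n coefC eqxx.
  have -> : (0 < e)%N = (sigma%:Z * D%:Z + rho * i%:Z != sigma%:Z * j%:Z)%R.
    by rewrite lt0n absz_eq0 subr_eq0.
  by case: eqP.
have s0 : rees_s != 0 by rewrite tofrac_eq0 polyX_eq0.
have -> : tofrac ((c *: 'X^i)%:P * 'X^e) = rees_const c * rees_t ^+ i * rees_s ^+ e.
  by rewrite -[c *: _]mul_polyC polyCM polyC_exp !tofracM !tofracXn.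
have sE : rees_s ^- sigma ^+ j * (rees_s ^ rho) ^+ i * rees_s ^+ (sigma * D) = rees_s ^+ e.
  have -> : rees_s ^- sigma ^+ j = rees_s ^ (- (sigma%:Z * j%:Z)).
    by rewrite -exprVn -exprM -PoszM -exprnN exprVn.
  rewrite [(_ ^ rho) ^+ i]exprnP exprz_exp [_ ^+ (sigma * D)]exprnP [_ ^+ e]exprnP -!expfzDr //.
  by congr exprz; rewrite PoszM /e; lia.
by rewrite -sE exprMn; ring.
Qed.

(** Here [i] is the exponent of [T] and [j] that of [v]. Since [sigma > 0], each [i] has at most one
    [j] on the critical line, so nothing cancels: a coefficient of [u] is a single coefficient of
    [P], or [0]. *)
Lemma has_rees_poly D (P : {poly {poly R}}) :
  (forall i j, P`_i`_j != 0 -> (sigma%:Z * j%:Z <= sigma%:Z * D%:Z + rho * i%:Z)%R) ->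
  exists u, [/\ has_rees D (rees_eval P) u,
    forall i j, (sigma%:Z * D%:Z + rho * i%:Z = sigma%:Z * j%:Z)%R -> u`_i = P`_i`_j &
    forall i, P`_i = 0 -> u`_i = 0].
Proof.
move=> bnd.
pose u1 i j : {poly R} :=
  if (sigma%:Z * D%:Z + rho * i%:Z == sigma%:Z * j%:Z)%R then P`_i`_j *: 'X^i else 0.
pose u : {poly R} := \sum_(i < size P) \sum_(j < size P`_i) u1 i j.
have uE m : u`_m = \sum_(j < size P`_m | (sigma%:Z * D%:Z + rho * m%:Z == sigma%:Z * j%:Z)%R) P`_m`_j.
  rewrite coef_sum; have [mP|mP] := ltnP m (size P); last first.
    rewrite [P`_m]nth_default // size_poly0 big_ord0 big1 // => i _; rewrite coef_sum big1 // => j _.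
    rewrite /u1; case: ifP => _; rewrite ?coef0 // coefZ coefXn gtn_eqF ?mulr0 //.
    exact: leq_trans mP.
  rewrite (bigD1 (Ordinal mP)) //= [X in _ + X]big1 ?addr0 => [|i im].
    rewrite coef_sum [RHS]big_mkcond; apply: eq_bigr => j _; rewrite /u1.
    by case: ifP => _; rewrite ?coef0 // coefZ coefXn eqxx mulr1.
  rewrite coef_sum big1 // => j _; rewrite /u1; case: ifP => _; rewrite ?coef0 // coefZ coefXn.
  by rewrite eq_sym -[m]/(nat_of_ord (Ordinal mP)) val_eqE (negbTE im) mulr0.
exists u; split=> [|i j ij|i Pi]; last 1 first.
- by rewrite uE Pi size_poly0 big_ord0.
- rewrite [rees_eval P](@horner_coef_wide _ (size P)) ?size_poly //.
  apply: (big_ind2 (has_rees D)) => [||i _]; first exact: (sym0 has_rees_symbol).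
    by move=> *; apply: (symD has_rees_symbol).
  have -> : (map_poly rees_eval1 P)`_i =
      \sum_(j < size P`_i) (map_poly rees_const P`_i)`_j * rees_s ^- sigma ^+ j.
    by rewrite coef_map; apply: (@horner_coef_wide _ (size P`_i)); rewrite size_poly.
  rewrite mulr_suml.
  apply: (big_ind2 (has_rees D)) => [||j _]; first exact: (sym0 has_rees_symbol).
    by move=> *; apply: (symD has_rees_symbol).
  have -> : (map_poly rees_const P`_i)`_j = rees_const P`_i`_j by rewrite coef_map.
  rewrite /u1; have [->|Pij] := eqVneq P`_i`_j 0.
    rewrite scale0r if_same [rees_const 0]rmorph0 !mul0r.
    by apply: (sym0 has_rees_symbol).
  by apply: has_rees_term; apply: bnd.
rewrite uE; have [jP|jP] := ltnP j (size P`_i).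
  rewrite (big_pred1 (Ordinal jP)) // => j'.
  rewrite /= -val_eqE /= ij; apply/eqP/eqP => [|->//]; nia.
rewrite [RHS]nth_default // big1 // => j' /eqP E; have := ltn_ord j'.
suff -> : nat_of_ord j' = j by rewrite ltnNge jP.
nia.
Qed.
End ReesSymbol.

(** * The leading term of the image of [x] under an automorphism *)

Lemma max_ratio (T : finType) (P : pred T) (t0 : T) (d : T -> int) (e : T -> nat) :
  P t0 -> (forall t, P t -> (0 < e t)%N) ->
  exists2 t, P t & forall u, P u -> (d u * (e t)%:Z <= d t * (e u)%:Z)%R.
Proof.
move=> Pt0 e0; pose r t : rat := (d t)%:~R / (e t)%:R.
have [t Pt tmax] := arg_maxP r Pt0.
exists t => // u Pu; have := tmax u Pu; rewrite /r /=.
have et : 0 < (e t)%:R :> rat by rewrite ltr0n e0.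
have eu : 0 < (e u)%:R :> rat by rewrite ltr0n e0.
rewrite ler_pdivrMr // mulrAC ler_pdivlMr //.
by rewrite !(pmulrn 1) -!intrM ler_int.
Qed.

Lemma poly2_support_bound (R : nzRingType) (P : {poly {poly R}}) :
  exists N, forall i j, P`_i`_j != 0 -> (i < N)%N /\ (j < N)%N.
Proof.
exists (maxn (size P) (\max_(i < size P) size (P`_i)%R)) => i j Pij.
have iP : (i < size P)%N.
  by apply: contraR Pij; rewrite -leqNgt => iP; rewrite [P`_i]nth_default // coef0.
have jP : (j < size (P`_i)%R)%N.
  by apply: contraR Pij; rewrite -leqNgt => jP; rewrite nth_default.
split; rewrite leq_max; first by rewrite iP.
apply/orP; right; apply: leq_trans jP _.
exact: (@leq_bigmax _ (fun i : 'I_(size P) => size (P`_i)%R) (Ordinal iP)).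
Qed.

Lemma Q2_hom_ext (k : fieldType) (R : comNzRingType) (h : {rmorphism k -> R})
    (f g : {rmorphism Q2 k -> R}) :
  (forall c u, f (c *: u) = h c * f u) -> (forall c u, g (c *: u) = h c * g u) ->
  (forall i, (i < 3)%N -> f (Q2_coord k i) = g (Q2_coord k i)) -> f =1 g.
Proof.
move=> fZ gZ fg u; elim/Q2_ind: u => [|c u v IHu IHv|u IHu]; first by rewrite !rmorph1.
  by rewrite !rmorphD fZ gZ IHu IHv.
by split; rewrite !rmorphM IHu fg.
Qed.

(** These are the coordinates of the additive action [z |-> z + x T] fixing [x]; the image of [y] is
    forced by the equation of the surface. *)
Fact Ga_orbit_eq (R : comNzRingType) (x y z : R) : x * y = z * (z + 1) ->
  x%:P * (y%:P + (z *+ 2 + 1)%:P * 'X + x%:P * 'X^2) =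
  (z%:P + x%:P * 'X) * (z%:P + x%:P * 'X + 1).
Proof.
move=> /(congr1 polyC); rewrite !polyCM !polyCD polyC1.
move: x%:P y%:P z%:P => u v w E; rewrite mulrDr mulrDr E; ring.
Qed.

Section LeadingTerm.
Variables (k : fieldType) (a : nat).
Hypotheses (a1 : (1 < a)%N) (a0 : a%:R != 0 :> k) (a20 : a.+2%:R != 0 :> k).
Variables (phi phi' : {lrmorphism Q2 k -> Q2 k}).
Hypothesis phiK : cancel phi phi'.
Hypothesis phi'K : cancel phi' phi.
Local Notation qx := (Q2_coord k 0).
Local Notation qy := (Q2_coord k 1).
Local Notation qz := (Q2_coord k 2).

Let hG : {rmorphism k -> {poly k}} := polyC.
(* [line hG big_line_eq] embeds the coordinate ring in [k[g][v]], with [v = z / x] and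
   [g = x / v ^ a], in such a way that the weight becomes the degree in [v]. *)
Definition big_line_eq : {poly {poly k}} := 'X%:P * 'X^a.
Local Notation iota := (line hG big_line_eq).

Lemma big_line_top : has_top a big_line_eq 'X.
Proof.
split; last by rewrite coefCM coefXn eqxx mulr1.
rewrite (leq_trans (size_polyMleq _ _)) // size_polyXn addnS /=.
by rewrite size_polyC polyX_eq0.
Qed.

Local Notation X := (iota (phi qx)).
Local Notation Y := (iota (phi qy)).
Local Notation Z := (iota (phi qz)).

Fact aut_coordE : X * Y = Z * (Z + 1).
Proof. exact: (Q2_coord_morph (iota \o phi)). Qed.

Definition hW : {rmorphism k -> {poly {poly {poly k}}}} := polyC \o (polyC \o polyC).

(* The conjugate by [phi] of the action [z |-> z + x T] of the additive group fixing [x]. *)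
Definition Ga_orbit : {rmorphism Q2 k -> {poly {poly {poly k}}}} :=
  Q2_eval hW (Ga_orbit_eq aut_coordE) \o phi'.

Lemma Ga_orbit_scale c f : Ga_orbit (c *: f) = hW c * Ga_orbit f.
Proof. by rewrite /Ga_orbit /= linearZ Q2_eval_scale. Qed.

Lemma Ga_orbit_fix : Ga_orbit (phi qx) = X%:P.
Proof. by rewrite /Ga_orbit /= phiK Q2_eval_x. Qed.

Lemma Ga_orbit0 f : (Ga_orbit f)`_0 = iota f.
Proof.
pose ev : {rmorphism Q2 k -> {poly {poly k}}} := horner_eval 0 \o Q2_eval hW (Ga_orbit_eq aut_coordE).
pose ip : {rmorphism Q2 k -> {poly {poly k}}} := iota \o phi.
have E : ev =1 ip.
  apply: (@Q2_hom_ext k _ (polyC \o polyC) ev ip) => [c u|c u|].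
  - by rewrite /ev /= Q2_eval_scale /horner_eval hornerM hornerC.
  - by rewrite /ip /= linearZ line_scale.
  case=> [|[|[|//]]] _; rewrite /ev /ip /= /horner_eval.
  - by rewrite Q2_eval_x hornerC.
  - by rewrite Q2_eval_y !hornerD hornerC !hornerM !hornerX !mulr0 !addr0.
  - by rewrite Q2_eval_z hornerD hornerC hornerM hornerX mulr0 addr0.
by rewrite -horner_coef0; have := E (phi' f); rewrite /ip /= phi'K.
Qed.

(** If the coordinates had orbits constant in [T], so would every function; but the orbit of
    [phi qz] is [Z + X T]. *)
Lemma Ga_orbit_nonconst : X != 0 -> exists2 i, (i < 3)%N & (1 < size (Ga_orbit (Q2_coord k i)))%N.
Proof.
move=> X0; apply: contrapT => nex.
have const i : (i < 3)%N -> (size (Ga_orbit (Q2_coord k i)) <= 1)%N.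
  by move=> i3; rewrite leqNgt; apply/negP => si; apply: nex; exists i.
suff H f : (size (Ga_orbit f) <= 1)%N.
  have := H (phi qz); rewrite /Ga_orbit /= phiK Q2_eval_z => /leq_sizeP/(_ 1%N isT).
  by rewrite coefD coefC coefMX coefC add0r => /eqP; rewrite (negbTE X0).
elim/Q2_ind: f => [|c f g sf sg|f sf]; first by rewrite rmorph1 size_poly1.
  rewrite rmorphD Ga_orbit_scale (leq_trans (size_polyD _ _)) // geq_max sg andbT.
  by rewrite (size1_polyC sf) -polyCM size_polyC_leq1.
by split; rewrite rmorphM (size1_polyC sf) (size1_polyC (const _ _)) // -polyCM size_polyC_leq1.
Qed.

Definition coord_weight (i : nat) := nth 0%N [:: a; a.+2; a.+1] i.

Lemma iota_coord_top i : (i < 3)%N -> has_top (coord_weight i) (iota (Q2_coord k i)) 'X.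
Proof.
have top := big_line_top.
case: i => [|[|[|//]]] _; [exact: line_top_x|exact: line_top_y|exact: line_top_z].
Qed.

(* [- rho / sigma] is the largest weight of [T] for which the action does not raise weights; the last
   clause says that the induced homogeneous action is not trivial. *)
Lemma Ga_orbit_slope : X != 0 -> exists (sigma : nat) (rho : int), [/\ (0 < sigma)%N,
  forall m i j, (m < 3)%N -> (Ga_orbit (Q2_coord k m))`_i`_j != 0 ->
    (sigma%:Z * j%:Z <= sigma%:Z * (coord_weight m)%:Z + rho * i%:Z)%R &
  exists m i j, [/\ (m < 3)%N, (0 < i)%N, (Ga_orbit (Q2_coord k m))`_i`_j != 0 &
    sigma%:Z * (coord_weight m)%:Z + rho * i%:Z = sigma%:Z * j%:Z]].
Proof.
move=> X0.
have [N NP] : exists N, forall m i j, (m < 3)%N -> (Ga_orbit (Q2_coord k m))`_i`_j != 0 ->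
    (i < N)%N /\ (j < N)%N.
  have bnd m := poly2_support_bound (Ga_orbit (Q2_coord k m)).
  have [N0 H0] := bnd 0; have [N1 H1] := bnd 1%N; have [N2 H2] := bnd 2%N.
  exists (N0 + N1 + N2)%N => m i j m3 Pij.
  case: m m3 Pij => [|[|[|//]]] _ => [/H0|/H1|/H2] []; lia.
pose T := ('I_3 * 'I_N * 'I_N)%type.
pose P (t : T) := (0 < t.1.2)%N && ((Ga_orbit (Q2_coord k t.1.1))`_t.1.2`_t.2 != 0).
have [t0 Pt0] : exists t0, P t0.
  have [m m3 sm] := Ga_orbit_nonconst X0.
  pose p := Ga_orbit (Q2_coord k m); pose i := (size p).-1.
  have i0 : (0 < i)%N by rewrite /i; case: (size p) sm => [|[]].
  have pi0 : p`_i != 0 by rewrite -/(lead_coef p) lead_coef_eq0 -size_poly_gt0 ltnW.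
  have pij : p`_i`_(size p`_i).-1 != 0 by rewrite -/(lead_coef _) lead_coef_eq0.
  have [iN jN] := NP _ _ _ m3 pij.
  by exists (Ordinal m3, Ordinal iN, Ordinal jN); rewrite /P /= i0.
(* A term [T^i v^j] in the orbit of the coordinate [m] raises the degree by [j - coord_weight m].
   The largest ratio of this number to [i] is [rho / sigma], and a triple attaining it gives the
   last clause. *)
pose d (t : T) : int := (t.2%:Z - (coord_weight t.1.1)%:Z)%R.
have [|t /andP[t_gt0 Pt] tmax] := @max_ratio _ P t0 d (fun t : T => t.1.2) Pt0.
  by move=> t /andP[].
exists t.1.2, (d t); split=> //.
  move=> m i j m3 Pij; have [iN jN] := NP _ _ _ m3 Pij.
  case: i iN Pij => [|i] iN Pij.
    rewrite mulr0 addr0 ler_wpM2l // lez_nat.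
    rewrite Ga_orbit0 // in Pij; have [sz _] := iota_coord_top m3.
    by rewrite -ltnS (leq_trans _ sz) //; apply: contraR Pij; rewrite -leqNgt => sj; rewrite nth_default.
  have := tmax (Ordinal m3, Ordinal iN, Ordinal jN); rewrite /P /= => /(_ Pij).
  rewrite /d /=; lia.
exists t.1.1, t.1.2, t.2; split=> //.
by rewrite /d; ring.
Qed.

(** Suppose [q.[1] = 0]. The symbol of [Phi (phi qx)] is computed in two ways: it is constant in [t]
    because the action fixes [phi qx], and it is the leading part evaluated at the symbols [xh],
    [yh], [zh]. By [leading_const] these are then constant, contrary to the choice of the slope. *)
Lemma leading_part_aut D q : (0 < D)%N -> q != 0 -> admissible a D q ->
  weight_lt a D (phi qx - leading_part a D q) -> q.[1] != 0.
Proof.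
move=> D0 q0 adq qD; apply/eqP => q1.
have Xtop : has_top D X q.
  have := line_top hG (big_line_top) adq qD.
  by rewrite -[(map_poly _ _).[_]]/(q \Po 'X) comp_polyXr.
have X0 : X != 0.
  by apply: contraNneq q0 => X0; move: Xtop.2; rewrite X0 coef0 => <-.
have [sigma [rho [sigma0 slope [m [i [j [m3 i0 Pij ijE]]]]]]] := Ga_orbit_slope X0.
pose Phi : {rmorphism Q2 k -> {fraction {poly {poly {poly k}}}}} :=
  rees_eval _ sigma rho \o Ga_orbit.
have symP := has_rees_symbol hG sigma0.
have hat n : (n < 3)%N -> exists u, [/\ has_rees sigma (coord_weight n) (Phi (Q2_coord k n)) u,
    forall i j, (sigma%:Z * (coord_weight n)%:Z + rho * i%:Z = sigma%:Z * j%:Z)%R ->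
      u`_i = (Ga_orbit (Q2_coord k n))`_i`_j & u`_0 = 'X].
  move=> n3; have [u [Hu uij _]] := has_rees_poly hG sigma0 (fun i j => slope n i j n3).
  exists u; split=> //; rewrite (uij _ (coord_weight n)) ?mulr0 ?addr0 // Ga_orbit0 //.
  by have [_ ->] := iota_coord_top n3.
have [xh [Hx xhE xh0]] := hat 0 isT.
have [yh [Hy yhE _]] := hat 1%N isT.
have [zh [Hz zhE _]] := hat 2%N isT.
have PhiZ c f : Phi (c *: f) = rees_const _ (hG c) * Phi f.
  by rewrite -(rees_eval_const sigma rho) -rmorphM -Ga_orbit_scale.
have sumE := sym_leading symP PhiZ Hx Hy Hz adq qD.
(* The orbit of [phi qx] is free of [T], and its coefficient of [v^D] is [q], read as a polynomial
   in [g]. *)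
have XE : has_rees sigma D (Phi (phi qx)) q%:P.
  have bnd i' j' : (X%:P)`_i'`_j' != 0 -> (sigma%:Z * j'%:Z <= sigma%:Z * D%:Z + rho * i'%:Z)%R.
    rewrite coefC; have [->|i'0] := eqVneq i' 0%N; last by rewrite coef0 eqxx.
    rewrite mulr0 addr0 => Xj; rewrite ler_wpM2l // lez_nat -ltnS.
    by rewrite (leq_trans _ Xtop.1) // ltnNge; apply: contra Xj => sj; rewrite nth_default.
  have [u [Hu uij ui]] := has_rees_poly hG sigma0 bnd.
  have -> : Phi (phi qx) = rees_eval _ sigma rho X%:P by rewrite -Ga_orbit_fix.
  rewrite (_ : q%:P = u) //; apply/polyP => -[|i'].
    by rewrite coefC (uij 0%N D) ?mulr0 ?addr0 // coefC eqxx Xtop.2.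
  by rewrite coefC ui // coefC.
have {sumE XE} sumE := has_rees_uniq sumE XE.
(* [z] has smaller weight than [z^2], so [z (z + 1)] has the symbol of [z^2]: the surface
   degenerates to the cone. *)
have xyz : xh * yh = zh ^+ 2.
  have Hxy := symM symP Hx Hy; have Hzz := symM symP Hz Hz.
  have wE : (coord_weight 2 + coord_weight 2 = coord_weight 0 + coord_weight 1)%N.
    by rewrite /coord_weight /=; lia.
  have wlt : (coord_weight 2 < coord_weight 2 + coord_weight 2)%N.
    by rewrite /coord_weight /=; lia.
  have := symD symP Hzz (symW symP Hz wlt); rewrite addr0 -expr2 wE.
  have -> : Phi qz * Phi qz + Phi qz = Phi qx * Phi qy.
    have expand (T : nzRingType) (u v w : T) : u * v = w * (w + 1) -> w * w + w = u * v.
      by move=> ->; rewrite mulrDr mulr1.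
    exact: expand (Q2_coord_morph Phi).
  exact: has_rees_uniq.
(* [leading_const] works over a field, so [k[g]] is embedded in its fraction field. *)
pose F : {rmorphism {poly k} -> {fraction {poly k}}} := @tofrac _.
pose hat_F : {rmorphism {poly {poly k}} -> {poly {fraction {poly k}}}} := map_poly F.
have Finj : injective F.
  by move=> u v /eqP; rewrite tofrac_eq => /eqP.
have sizeF u : size (hat_F u) = size u by rewrite size_map_inj_poly ?rmorph0.
have monF x y z n l : hat_F (monom x y z n l) = monom (hat_F x) (hat_F y) (hat_F z) n l.
  by rewrite /monom !rmorphM !rmorphXn.
have [] := @leading_const k _ (F \o polyC) a D a1 a0 a20 (hat_F xh) (hat_F yh) (hat_F zh) q (F q).
- by rewrite -rmorphM xyz rmorphXn.
- rewrite -size_poly_gt0 sizeF size_poly_gt0; apply: contra_eq_neq xh0 => ->.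
  by rewrite coef0 eq_sym polyX_eq0.
- exact: D0.
- exact: adq.
- by rewrite -(rmorph0 F) (inj_eq Finj).
- exact: q1.
- have := congr1 hat_F sumE; rewrite rmorph_sum /= => E.
  rewrite -[RHS]map_polyC -[RHS]E; apply: eq_bigr => n _.
  by rewrite rmorphM monF /= !map_polyC.
rewrite !sizeF => sx sy sz.
(* The nonzero coefficient of index [i > 0] provided by the slope contradicts constancy. *)
have : forall u, (size u <= 1)%N -> u`_i = (Ga_orbit (Q2_coord k m))`_i`_j -> False.
  by move=> u su uE; move: Pij; rewrite -uE nth_default ?eqxx // (leq_trans su).
case: m m3 Pij ijE => [|[|[|//]]] _ _ ijE contra.
- exact: (contra xh sx (xhE _ _ ijE)).
- exact: (contra yh sy (yhE _ _ ijE)).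
exact: (contra zh sz (zhE _ _ ijE)).
Qed.

End LeadingTerm.

(** * Kernel ideals, their quotients and Krull dimension *)

Section KernelIdeal.
Variables (R : comNzRingType) (S : idomainType) (f : {rmorphism R -> S}).

Definition ker_ideal : R -> bool := fun u => f u == 0.

Fact ker_ideal_closed : idealr_closed ker_ideal.
Proof.
split; rewrite -?topredE /= /ker_ideal ?rmorph0 ?rmorph1 ?oner_eq0 // => c u v.
by rewrite -!topredE /= => /eqP u0 /eqP v0; rewrite rmorphD rmorphM u0 v0 mulr0 addr0.
Qed.

Fact ker_ideal_prime : prime_idealr_closed ker_ideal.
Proof. by move=> u v; rewrite -!topredE /= /ker_ideal rmorphM mulf_eq0. Qed.

HB.instance Definition _ := isIdealr.Build R ker_ideal ker_ideal_closed.
HB.instance Definition _ := isPrimeIdealrClosed.Build R ker_ideal ker_ideal_prime.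

End KernelIdeal.

Section KrullDimension.
Variables (k : fieldType) (A : comAlgType k) (f : {lrmorphism A -> {poly k}}).
Hypothesis f_inj : injective f.
Hypothesis f_surj : forall p, exists u, f u = p.

(** An element [x] of [P] whose image has least degree generates [P]. For [y] in [Q] outside [P],
    let [d] be a gcd of [x] and [y] and [x = e d]. Then [e] lies in [P], hence is a multiple of [x],
    and [d] is a unit lying in [Q]. *)
Lemma prime_maximal (P Q : prime_idealr A) u : u \in P -> u != 0 ->
  {subset P <= Q} -> {subset Q <= P}.
Proof.
move=> uP u0 PQ y yQ; apply: contrapT => /negP yP.
have f0 v : (f v == 0) = (v == 0) by rewrite -(inj_eq f_inj) rmorph0.
pose small n := `[< exists v, [/\ v \in P, v != 0 & size (f v) = n] >].
have exs : exists n, small n by exists (size (f u)); apply/asboolP; exists u.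
have [n /asboolP[x [xP x0 xn]] nmin] := ex_minnP exs.
have divP v : v \in P -> exists c, v = c * x.
  move=> vP; have [c cE] := f_surj (f v %/ f x); exists c.
  apply: contrapT => /eqP; rewrite -subr_eq0 => vc0.
  have : (n <= size (f (v - c * x))%R)%N.
    apply: nmin; apply/asboolP; exists (v - c * x); split=> //.
    by rewrite rpredB // idealMr.
  rewrite rmorphB rmorphM /= cE {1}(divp_eq (f v) (f x)) addrC addKr leqNgt -xn ltn_modp.
  by rewrite f0 x0.
have [[p q] /= pq] := Bezoutp (f x) (f y).
have [[p' pE] [q' qE]] := (f_surj p, f_surj q).
pose d := p' * x + q' * y.
have dE : f d %= gcdp (f x) (f y) by rewrite rmorphD !rmorphM /= pE qE.
have dQ : d \in Q by rewrite rpredD // idealMr // PQ.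
have dvd v : f d %| f v -> exists c, v = c * d.
  move=> /dvdpP[c cE]; have [c' c'E] := f_surj c; exists c'.
  by apply: f_inj; rewrite rmorphM /= c'E.
have [e eE] : exists e, x = e * d by apply: dvd; rewrite (eqp_dvdl _ dE) dvdp_gcdl.
have [c yE] : exists c, y = c * d by apply: dvd; rewrite (eqp_dvdl _ dE) dvdp_gcdr.
have dP : d \notin P by apply: contraNN yP => dP; rewrite yE idealMr.
have eP : e \in P by move: xP; rewrite eE prime_idealrM (negbTE dP) orbF.
have [g gE] := divP _ eP.
have : g * d = 1.
  apply: f_inj; apply: (@mulIf _ (f x)); first by rewrite f0.
  by rewrite -!rmorphM mul1r mulrAC -gE -eE.
move=> /(congr1 (fun v => v \in Q)); rewrite idealr1 idealMr //.
Qed.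

Lemma krull_dim1 : krull_dim_eq A 1.
Proof.
move=> m; split=> [[p chain]|].
  rewrite leqNgt; apply/negP => m1.
  have i1 : (1 < m.+1)%N by apply: ltnW.
  have [p01 p10] := chain ord0 (Ordinal i1) isT.
  have [p12 p21] := chain (Ordinal i1) (Ordinal (m1 : (2 < m.+1)%N)) isT.
  apply: p10 => u u1; apply: contrapT => /negP u0; apply: p21.
  by apply: (prime_maximal u1) => //; apply: contraNneq u0 => ->; apply: idealr0.
(* The zero ideal and the ideal of the point of parameter [0]; for [m = 0] only the first occurs. *)
pose p0 : prime_idealr A := ker_ideal f.
pose p1 : prime_idealr A := ker_ideal (horner_eval 0 \o f).
move=> m1; exists (fun i : 'I_m.+1 => if i == 0%N :> nat then p0 else p1) => i j ij.
have -> : i = 0%N :> nat by have := ltn_ord j; lia.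
have -> : (nat_of_ord j == 0%N) = false by lia.
split=> [u|/(_ _)].
  by rewrite -!topredE /= /ker_ideal /= => /eqP->; rewrite /horner_eval horner0.
have [x xE] := f_surj 'X => /(_ x).
by rewrite -!topredE /= /ker_ideal /= xE /horner_eval hornerX eqxx polyX_eq0 => /(_ isT).
Qed.

End KrullDimension.

Section KernelQuotient.
Variables (k : fieldType) (A : comAlgType k) (S : idomainType).
Variables (h : {rmorphism k -> S}) (f : {rmorphism A -> S}).
Local Notation P := (ker_ideal f : prime_idealr A).

Definition ker_quot (x : {ideal_quot P}) : S := f (repr x).

Lemma ker_quot_pi u : ker_quot (\pi_{ideal_quot P} u) = f u.
Proof.
apply/eqP; rewrite -subr_eq0 -rmorphB.
have : repr (\pi_{ideal_quot P} u) - u \in P by rewrite Quotient.idealrBE reprK.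
by [].
Qed.

Fact ker_quot_zmod : zmod_morphism ker_quot.
Proof. by move=> x y; rewrite -[x]reprK -[y]reprK -rmorphB !ker_quot_pi rmorphB. Qed.

Fact ker_quot_monoid : monoid_morphism ker_quot.
Proof.
split=> [|x y]; first by rewrite -(rmorph1 \pi_{ideal_quot P}) ker_quot_pi rmorph1.
by rewrite -[x]reprK -[y]reprK -rmorphM !ker_quot_pi rmorphM.
Qed.

Lemma ker_quot_inj : injective ker_quot.
Proof.
move=> x y; rewrite -[x]reprK -[y]reprK !ker_quot_pi => /eqP; rewrite -subr_eq0 -rmorphB => xy.
by apply/eqP; rewrite -Quotient.idealrBE.
Qed.

End KernelQuotient.

(** * The lines as closed curves isomorphic to the affine line *)

Section LineQuotient.
Variables (k : fieldType) (f : {poly k}).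
Local Notation qx := (Q2_coord k 0).
Local Notation qy := (Q2_coord k 1).
Local Notation qz := (Q2_coord k 2).
Local Notation theta := (line idfun f).

Definition line_curve : prime_idealr (Q2 k) := ker_ideal theta.
Local Notation Q := {ideal_quot line_curve}.

Lemma in_line_curve u : (u \in line_curve) = (theta u == 0).
Proof. by []. Qed.

Definition line_quot : Q -> {poly k} := @ker_quot k (Q2 k) _ theta.

HB.instance Definition _ := GRing.isZmodMorphism.Build Q {poly k} line_quot (@ker_quot_zmod _ _ _ _).
HB.instance Definition _ := GRing.isMonoidMorphism.Build Q {poly k} line_quot (@ker_quot_monoid _ _ _ _).

Fact line_quot_scalable : scalable line_quot.
Proof.
move=> c x; rewrite -[x]reprK.
have -> : c *: \pi_Q (repr x) = \pi_Q (c *: repr x) by exact: quot_scaleE.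
by rewrite /line_quot !ker_quot_pi /= line_scale mul_polyC.
Qed.
HB.instance Definition _ := GRing.isScalable.Build k Q {poly k} *:%R line_quot line_quot_scalable.

Variable a : nat.
Hypotheses (a0 : (0 < a)%N) (fmon : f \is monic) (fsize : size f = a.+1).

(* [t = y - t * z]: multiplying by [x] or [1 + z] brings [t] into the image, and these two generate
   the unit ideal because [z ^ a] is a multiple of [x]. *)
Lemma line_param : exists u, theta u = 'X.
Proof.
(* On the curve [x w = z^a], since [f] is monic, and [(z + 1) s = z^a - (-1)^a]. Hence
   [x w - (z + 1) s = (-1)^a]; multiplication by [t] turns [x] into [z] and [z + 1] into [y]. *)
pose s : Q2 k := \sum_(i < a) qz ^+ (a.-1 - i) * (-1) ^+ i.
pose w : Q2 k := qx ^+ a - \sum_(i < a) f`_i *: (qz ^+ i * qx ^+ (a.-1 - i)).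
have sE : qz ^+ a - (-1) ^+ a = (qz + 1) * s by rewrite subrXX opprK.
have fa : f ^+ a = f ^+ a.-1 * f by rewrite -exprSr prednK.
have fE : f - \sum_(i < a) f`_i *: 'X^i = 'X^a.
  rewrite -{1}[f]coefK poly_def fsize big_ord_recr /= addrAC subrr add0r.
  by have /monicP := fmon; rewrite /lead_coef fsize /= => ->; rewrite scale1r.
have wE : theta qx * theta w = theta qz ^+ a.
  rewrite /w rmorphB rmorphXn rmorph_sum /= line_x line_z.
  rewrite mulrBr mulr_sumr.
  have -> : \sum_(i < a) f * theta (f`_i *: (qz ^+ i * qx ^+ (a.-1 - i))) =
      f ^+ a * (\sum_(i < a) f`_i *: 'X^i).
    rewrite mulr_sumr; apply: eq_bigr => i _.
    rewrite line_scale rmorphM !rmorphXn /= line_x line_z exprMn.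
    rewrite -(mulrA ('X^i)) -exprD -mul_polyC.
    have -> : (i + (a.-1 - i) = a.-1)%N by have := ltn_ord i; lia.
    by rewrite fa; move: (f ^+ _) 'X^i => u v; ring.
  by rewrite [f * _]mulrC -mulrBr fE exprMn mulrC.
have s'E : (theta qz + 1) * theta s = theta qz ^+ a - (-1) ^+ a.
  have := congr1 theta sE.
  by rewrite rmorphB rmorphM rmorphD !rmorphXn rmorphN rmorph1 => ->.
exists ((-1) ^+ a * (qz * w - qy * s)).
rewrite rmorphM rmorphB !rmorphM rmorphXn rmorphN rmorph1 /=.
have -> : theta qz * theta w - theta qy * theta s = 'X * (theta qx * theta w - (theta qz + 1) * theta s).
  by rewrite line_y line_z line_x; ring.
rewrite wE s'E opprB addrC subrK mulrCA -exprMn mulrNN mulr1 expr1n mulr1 //.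
Qed.

Lemma line_surj p : exists u, theta u = p.
Proof.
have [t tE] := line_param; exists (\sum_(i < size p) p`_i *: t ^+ i).
rewrite rmorph_sum /= -[RHS]coefK poly_def; apply: eq_bigr => i _.
by rewrite line_scale rmorphXn /= tE mul_polyC.
Qed.

Lemma line_quot_surj p : exists x, line_quot x = p.
Proof.
by have [u uE] := line_surj p; exists (\pi_Q u); rewrite /line_quot ker_quot_pi.
Qed.

Lemma line_curve_iso : alg_iso Q {poly k}.
Proof.
exists line_quot; have [g gK] := boolp.choice line_quot_surj.
by exists g => // x; apply: ker_quot_inj; apply: gK.
Qed.

Lemma line_curve_closed : closed_curve line_curve.
Proof. apply: (@krull_dim1 _ _ (line_quot : {lrmorphism Q -> {poly k}})); last exact: line_quot_surj.
exact: ker_quot_inj. Qed.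

End LineQuotient.

(** * Automorphisms carrying one line to another *)

Section Rigidity.
Variable k : fieldType.

Lemma lrmorphism_inv (A : comAlgType k) (phi : {lrmorphism A -> A}) : bijective phi ->
  exists phi' : {lrmorphism A -> A}, cancel phi phi' /\ cancel phi' phi.
Proof.
move=> [psi phiK psiK].
pose psiA := GRing.isZmodMorphism.Build A A psi (can2_zmod_morphism phiK psiK).
pose psiM := GRing.isMonoidMorphism.Build A A psi (can2_monoid_morphism phiK psiK).
pose psiZ := GRing.isScalable.Build k A A *:%R psi (can2_scalable phiK psiK).
pose phi' : {lrmorphism A -> A} := HB.pack psi psiA psiM psiZ.
by exists phi'.
Qed.

(** [p] expresses the parameter of the second line in that of the first. Its degree is 1 because the
    parameter of the first line is in turn a polynomial in [p]. *)
Lemma maps_onto_reparam (f g : {poly k}) (a b : nat) (phi : {lrmorphism Q2 k -> Q2 k}) :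
  (0 < a)%N -> f \is monic -> size f = a.+1 ->
  (0 < b)%N -> g \is monic -> size g = b.+1 ->
  bijective phi -> maps_onto phi (line_curve f) (line_curve g) ->
  exists2 p : {poly k}, size p = 2%N & forall u, line idfun f (phi u) = line idfun g u \Po p.
Proof.
move=> a0 fmon fsize b0 gmon gsize [phi' phiK phi'K] onto.
have [t tE] := line_param b0 gmon gsize; pose p := line idfun f (phi t).
have pE u : line idfun f (phi u) = line idfun g u \Po p.
  pose v := \sum_(i < size (line idfun g u)) (line idfun g u)`_i *: t ^+ i.
  have vE : line idfun g v = line idfun g u.
    rewrite rmorph_sum /= -[RHS]coefK poly_def; apply: eq_bigr => i _.
    by rewrite line_scale rmorphXn /= tE mul_polyC.
  have : u - v \in line_curve g by rewrite in_line_curve rmorphB /= vE subrr.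
  rewrite -onto in_line_curve !rmorphB /= subr_eq0 => /eqP->.
  rewrite [RHS]comp_polyE /v (rmorph_sum phi) (rmorph_sum (line idfun f)); apply: eq_bigr => i _ /=.
  by rewrite linearZ line_scale mul_polyC !rmorphXn.
exists p => //; have [w wE] := line_param a0 fmon fsize.
have := congr1 (fun r : {poly k} => (size r).-1) (pE (phi' w)).
rewrite phi'K wE size_polyX size_comp_poly => /esym/eqP; rewrite muln_eq1 => /andP[_].
by case: (size p) => [|[|[|n]]].
Qed.

(** As [a > 1], the only monomials of weight at most [a] are [1] and [x]. *)
Lemma weight_lt_affine a D (u : Q2 k) : (1 < a)%N -> weight_lt a D u -> (D <= a.+1)%N ->
  exists c0 c1, u = c0 *: 1 + c1 *: Q2_coord k 0.
Proof.
move=> a1; elim=> [|c n l {}u ln lD _ IH] Da; first by exists 0, 0; rewrite !scale0r addr0.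
have [c0 [c1 ->]] := IH Da.
have n1 : (n <= 1)%N by rewrite leqNgt; apply/negP => n2; have := leq_mul2l a 2 n; lia.
case: n n1 ln lD => [|[|//]] _ ln lD.
  have -> : l = 0%N by lia.
  by exists (c + c0), c1; rewrite /monom !expr0 !mulr1 scalerDl addrA.
have -> : l = 0%N by lia.
by exists c0, (c + c1); rewrite /monom /= !expr0 expr1 !mulr1 scalerDl addrCA.
Qed.

Lemma weight_lt_leading a D q : admissible a D q -> weight_lt a D.+1 (@leading_part k a D q).
Proof.
move=> adq; apply: big_ind => [||n _]; first exact: weight_lt0.
  by move=> u v; apply: weight_lt_add.
have [->|/adq ad] := eqVneq q`_n 0; first by rewrite scale0r; apply: weight_lt0.
by apply: weight_lt_scale; apply: weight_lt_mon; lia.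
Qed.

(** Along the curve of [f], the function [phi qx] is [g \Po p], of degree [b]. Since [q.[1]] is
    nonzero, this degree is the weight [D], so [D <= a] and [weight_lt_affine] applies. *)
Lemma aut_coord_affine (f g p : {poly k}) (a b : nat) (phi : {lrmorphism Q2 k -> Q2 k}) :
  (1 < a)%N -> a%:R != 0 :> k -> a.+2%:R != 0 :> k ->
  f \is monic -> size f = a.+1 -> (0 < b <= a)%N -> size g = b.+1 -> size p = 2%N ->
  bijective phi -> (forall u, line idfun f (phi u) = line idfun g u \Po p) ->
  exists c0 c1, g \Po p = c0%:P + c1 *: f.
Proof.
move=> a1 ak a2k fmon fsize /andP[b0 ba] gsize psize /lrmorphism_inv[phi' [phiK phi'K]] pE.
have X0 : phi (Q2_coord k 0) != 0.
  apply/eqP => /(congr1 (line idfun f)); rewrite pE rmorph0 line_x.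
  move=> /(congr1 (fun r : {poly k} => size r)).
  by rewrite size_comp_poly2 // gsize size_poly0.
have [D [q [q0 adq qD]]] := leading_part_ex a X0.
have ftop : has_top a f 1.
  by split; rewrite ?fsize //; have /monicP := fmon; rewrite /lead_coef fsize.
have [sD cD] := line_top idfun ftop adq qD; rewrite map_poly_id // in cD.
rewrite pE line_x in sD cD.
have D0 : (0 < D)%N by move: sD; rewrite size_comp_poly2 // gsize; lia.
have q1 : q.[1] != 0.
  exact: (leading_part_aut a1 ak a2k phiK phi'K D0 q0 adq qD).
have DE : D = b.
  apply/eqP; rewrite -eqSS eqn_leq -gsize -(size_comp_poly2 g psize) sD andbT.
  by rewrite ltnNge; apply: contra q1 => sz; rewrite -cD nth_default.
have [c0 [c1 XE]] : exists c0 c1, phi (Q2_coord k 0) = c0 *: 1 + c1 *: Q2_coord k 0.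
  apply: (weight_lt_affine a1 (D := D.+1)); last by rewrite ltnS DE.
  rewrite -[phi _](subrK (leading_part a D q)); apply: weight_lt_add (weight_lt_leading adq).
  exact: weight_lt_leq qD.
exists c0, c1; have := pE (Q2_coord k 0).
by rewrite line_x XE rmorphD /= !line_scale rmorph1 line_x mulr1 mul_polyC.
Qed.

End Rigidity.

(** * Polynomials without affine equivalences, and suitable exponents *)

Section Family.
Variable k : fieldType.

(** The missing term in [t^(a-1)] excludes translations when [a] is nonzero in [k], the terms in
    [t^(a-2)] and [t^(a-3)] exclude homotheties, and [s] parametrizes the family. For [a > 4] the
    exponents are distinct. *)
Definition rigid_poly (a : nat) (s : k) : {poly k} := 'X^a + ('X^(a - 2) + 'X^(a - 3) + s *: 'X).

Lemma rigid_poly_size a s : (4 < a)%N -> size (rigid_poly a s) = a.+1.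
Proof.
move=> a4; rewrite /rigid_poly size_polyDl size_polyXn // ltnS.
rewrite (leq_trans (size_polyD _ _)) // geq_max (leq_trans (size_polyD _ _)) ?geq_max ?size_polyXn.
  by rewrite (leq_trans (size_scale_leq _ _)) // size_polyX; lia.
by apply/andP; split; lia.
Qed.

Lemma rigid_poly_monic a s : (4 < a)%N -> rigid_poly a s \is monic.
Proof.
move=> a4; rewrite monicE /lead_coef rigid_poly_size //= /rigid_poly !coefD !coefXn coefZ coefX.
by rewrite eqxx !gtn_eqF ?mulr0 ?addr0 //; lia.
Qed.

Lemma coef_rigid_poly a s i : (rigid_poly a s)`_i =
  (i == a)%:R + ((i == a - 2)%N%:R + (i == a - 3)%N%:R + s * (i == 1%N)%:R).
Proof. by rewrite /rigid_poly !coefD !coefXn coefZ coefX. Qed.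

Lemma rigid_poly_affine a s s' (p : {poly k}) c0 c1 :
  (4 < a)%N -> a%:R != 0 :> k -> size p = 2%N ->
  rigid_poly a s \Po p = c0%:P + c1 *: rigid_poly a s' -> p = 'X /\ s = s'.
Proof.
move=> a4 ak psize E.
have [nu [mu [mu0 pE]]] : exists nu mu, mu != 0 /\ p = nu%:P + mu *: 'X.
  exists p`_0, p`_1; split.
    by have := lead_coef_eq0 p; rewrite /lead_coef psize -size_poly_eq0 psize => ->.
  by rewrite -[LHS]coefK poly_def psize !big_ord_recr big_ord0 /= add0r expr0 expr1 alg_polyC.
have sizeX m : size (p ^+ m) = m.+1.
  have p0 : p != 0 by rewrite -size_poly_eq0 psize.
  by rewrite -[LHS]prednK ?size_poly_gt0 ?expf_neq0 // size_exp psize mul1n.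
have top m : (p ^+ m)`_m = mu ^+ m.
  elim: m => [|m IH]; first by rewrite !expr0 coefC.
  rewrite exprS {1}pE mulrDl mul_polyC -scalerAl coefD !coefZ coefXM /= IH.
  by rewrite nth_default ?sizeX // mulr0 add0r exprS.
have subtop n : (p ^+ n.+1)`_n = n.+1%:R * mu ^+ n * nu.
  elim: n => [|n IH]; first by rewrite expr1 pE coefD coefC coefZ coefX mulr0 addr0 mulr1 mul1r.
  rewrite exprS {1}pE mulrDl mul_polyC -scalerAl coefD !coefZ coefXM /= IH top.
  by rewrite [n.+2%:R]mulrS exprS; ring.
have compE : rigid_poly a s \Po p = p ^+ a + (p ^+ (a - 2) + p ^+ (a - 3) + s *: p).
  by rewrite /rigid_poly !comp_polyD comp_polyZ !comp_Xn_poly comp_polyX.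
case: a a4 ak sizeX E compE => [|[|[|[|[|b]]]]] // _ ak sizeX E compE.
have neq m n : (m < n)%N -> ((m == n) = false) * ((n == m) = false).
  by move=> mn; rewrite ltn_eqF ?gtn_eqF.
(* Coefficient of index [a - 1], with [a = b + 5]: only [p^a] contributes, by [a mu^(a-1) nu]. *)
have nu0 : nu = 0.
  have := congr1 (fun r : {poly k} => r`_b.+4) E.
  rewrite compE !coefD coefZ subtop coefC coefZ coef_rigid_poly !subSS !subn0 /=.
  rewrite ![_`_b.+4]nth_default ?sizeX ?psize ?size_polyC_leq1 //.
  rewrite (neq b.+4 b.+4.+1) // (neq b.+3 b.+4) // (neq b.+2 b.+4) // !(mulr0, addr0, add0r) => /eqP.
  rewrite mulf_eq0 => /orP[|/eqP//].
  by rewrite mulf_eq0 (negbTE ak) expf_eq0 (negbTE mu0) andbF.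
rewrite nu0 add0r in pE; rewrite {}pE in E compE *.
have coefE i : mu ^+ i * (rigid_poly b.+4.+1 s)`_i = (c0%:P)`_i + c1 * (rigid_poly b.+4.+1 s')`_i.
  have := congr1 (fun r : {poly k} => r`_i) E; rewrite coefD coefZ => <-.
  rewrite compE !exprZn !coefD !coefZ !coefXn coefX.
  have powE n : mu ^+ n * (i == n)%:R = mu ^+ i * (i == n)%:R :> k.
    by case: eqP => [->//|_]; rewrite !mulr0.
  have := powE 1%N; rewrite expr1 => ->.
  by rewrite !powE; ring.
(* Indices [a], [a - 2], [a - 3] give [mu^a = mu^(a-2) = mu^(a-3) = c1], so [mu = c1 = 1]; index [1]
   then gives [s = s']. *)
have Ea := coefE b.+4.+1; have E3 := coefE b.+3; have E2 := coefE b.+2; have E1 := coefE 1%N.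
rewrite !coef_rigid_poly !coefC !subSS !subn0 /= in Ea E3 E2 E1.
have lt25 : (b.+2 < b.+4.+1)%N by lia.
rewrite !eqxx !(neq b.+2 b.+3) ?(neq _ _ lt25) ?(neq b.+3 b.+4.+1) // in Ea E3 E2 E1.
rewrite /= !(mulr0, addr0, add0r, mulr1, expr1) in Ea E3 E2 E1.
have c10 : c1 != 0 by rewrite -Ea expf_neq0.
have mu1 : mu = 1 by apply: (mulIf c10); rewrite mul1r -{1}E2 -exprS.
rewrite mu1 expr1n in Ea; rewrite mu1 -Ea !mul1r in E1.
by rewrite mu1 scale1r.
Qed.

(** In characteristic [p] the exponents [p (n + 6) - 1] are [-1] modulo [p], and adding [2] gives
    [1]; in characteristic [0] nonvanishing is automatic. *)
Lemma good_exponents : exists b : nat -> nat, [/\ injective b, forall n, (4 < b n)%N,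
  forall n, (b n)%:R != 0 :> k & forall n, (b n).+2%:R != 0 :> k].
Proof.
have [[p pk]|/forallNP nop] := pselect (exists p, p \in [pchar k]).
  have p1 : (1 < p)%N by rewrite prime_gt1 // (pcharf_prime pk).
  have p0 n : (p * (n + 6))%:R = 0 :> k by rewrite natrM (pcharf0 pk) mul0r.
  have b0 n : (p * (n + 6))%N = (p * (n + 6)).-1.+1 by rewrite prednK // muln_gt0; lia.
  exists (fun n => (p * (n + 6)).-1); split=> [m n mn|n|n|n].
  - have : (p * (m + 6) = p * (n + 6))%N by rewrite b0 mn -b0.
    by move/eqP; rewrite eqn_pmul2l; lia.
  - have := leq_mul p1 (leq_addl n 6); lia.
  - apply/eqP => bn; have := p0 n; rewrite b0 -addn1 natrD bn add0r => /eqP.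
    by rewrite oner_eq0.
  by rewrite -b0 -addn1 natrD p0 add0r oner_neq0.
have char0 : [pchar k] =i pred0 by move=> p; apply/negP => pk; apply: (nop p).
exists (fun n => n + 5)%N; split=> [m n /addIn//|n|n|n]; first by rewrite addnC.
  by have /(pcharf0P k) -> := char0; rewrite addnS.
by have /(pcharf0P k) -> := char0.
Qed.

End Family.

(** * Inequivalence and rigidity of the curves *)

Section RigidFamily.
Variables (k : fieldType) (b : nat -> nat).
Hypotheses (b_inj : injective b) (b4 : forall n, (4 < b n)%N).
Hypotheses (bk : forall n, (b n)%:R != 0 :> k) (b2k : forall n, (b n).+2%:R != 0 :> k).

Definition rigid_curve (i : k * nat) : prime_idealr (Q2 k) := line_curve (rigid_poly (b i.2) i.1).

Let mon (i : k * nat) := rigid_poly_monic i.1 (b4 i.2).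
Let siz (i : k * nat) := rigid_poly_size i.1 (b4 i.2).
Let pos (i : k * nat) : (0 < b i.2)%N. Proof. exact: ltnW (ltnW (ltnW (ltnW (b4 i.2)))). Qed.

Lemma rigid_curve_maps_onto_le i j (phi : {lrmorphism Q2 k -> Q2 k}) : (b j.2 <= b i.2)%N ->
  bijective phi -> maps_onto phi (rigid_curve i) (rigid_curve j) ->
  i = j /\ forall u, line idfun (rigid_poly (b i.2) i.1) (phi u) = line idfun (rigid_poly (b i.2) i.1) u.
Proof.
move=> ji phi_bij onto.
have [p psize pE] := maps_onto_reparam (pos i) (mon i) (siz i) (pos j) (mon j) (siz j) phi_bij onto.
have b1 : (1 < b i.2)%N by exact: ltnW (ltnW (ltnW (b4 i.2))).
have bji : (0 < b j.2 <= b i.2)%N by rewrite pos.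
have [c0 [c1 E]] := aut_coord_affine b1 (bk _) (b2k _) (mon i) (siz i) bji (siz j) psize phi_bij pE.
(* The left-hand side of [E] is not constant, so [c1] is nonzero and the degrees agree. *)
have bE : b j.2 = b i.2.
  have /eqP := congr1 (fun r : {poly k} => size r) E; rewrite size_comp_poly2 // siz.
  have [->|c10] := eqVneq c1 0; last first.
    by rewrite addrC size_polyDl size_scale // siz ?ltnS ?(leq_trans (size_polyC_leq1 _)) // => /eqP[].
  by rewrite scale0r addr0 size_polyC gtn_eqF // ltnS; case: (c0 != 0).
rewrite bE in E; have [pX ss] := rigid_poly_affine (b4 _) (bk _) psize E.
have ij : i = j by case: i j ss bE {ji phi_bij onto pE b1 bji E} => [s m] [s' n] /= -> /b_inj ->.
by split=> // u; rewrite pE pX comp_polyXr -ij.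
Qed.

Lemma rigid_curve_maps_onto i j (phi : {lrmorphism Q2 k -> Q2 k}) :
  bijective phi -> maps_onto phi (rigid_curve i) (rigid_curve j) -> i = j.
Proof.
move=> phi_bij onto; have [ji|/ltnW ij] := leqP (b j.2) (b i.2).
  by have [] := rigid_curve_maps_onto_le ji phi_bij onto.
(* For [b i.2 < b j.2] the inverse automorphism exchanges the roles. *)
have [phi' [phiK phi'K]] := lrmorphism_inv phi_bij.
have [||-> //] := rigid_curve_maps_onto_le (phi := phi') ij.
  by exists phi.
by move=> u; rewrite -onto phi'K.
Qed.

Lemma rigid_curve_family : rigid_line_family rigid_curve.
Proof.
split=> [i|i j ij [phi [phi_bij onto]]|i|i beta beta_bij].
- exact: (line_curve_closed (pos i) (mon i) (siz i)).
- exact: ij (rigid_curve_maps_onto phi_bij onto).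
- exact: (line_curve_iso (pos i) (mon i) (siz i)).
split=> [[alpha [alpha_bij onto alphaE]] x|beta1].
  have [_ aE] := rigid_curve_maps_onto_le (leqnn _) alpha_bij onto.
  rewrite -[x]reprK alphaE; apply/eqP; rewrite -Quotient.idealrBE.
  by rewrite in_line_curve rmorphB /= aE subrr.
exists idfun; split=> [|u|u]; first by exists idfun.
  by [].
by rewrite beta1.
Qed.

End RigidFamily.

Theorem theorem1 (k : fieldType) :
  (exists (I : Type) (C : I -> prime_idealr (Q2 k)),
     infinite_set [set: I]%classic /\ rigid_line_family C)
  /\
  (~ countable [set: k]%classic ->
   exists (I : Type) (C : I -> prime_idealr (Q2 k)),
     ~ countable [set: I]%classic /\ rigid_line_family C).
Proof.
have [b [b_inj b4 bk b2k]] := good_exponents k.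
have fam := rigid_curve_family b_inj b4 bk b2k.
(* The factor [nat] makes the family infinite over finite fields as well, and the factor [k] makes
   it uncountable when [k] is. *)
split=> [|unc]; exists (k * nat)%type, (rigid_curve b); split=> //.
  move=> fin; apply: infinite_nat.
  have -> : [set: nat]%classic = (@snd k nat @` [set: k * nat])%classic.
    by apply/seteqP; split=> // n _; exists (0, n).
  exact: finite_image.
move=> cnt; apply: unc.
have -> : [set: k]%classic = (@fst k nat @` [set: k * nat])%classic.
  by apply/seteqP; split=> // n _; exists (n, 0%N).
by apply: card_le_trans cnt; apply: card_image_le.
Qed.
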